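(* Let $d\in\mathbb{N}$, $d\ge 1$, and let $\rho\in\mathcal{S}(\mathbb{R}^d)$ be even with $\int\rho(x)\,dx=1$ and $\int x^m\rho(x)\,dx=0$ for all $m\in\mathbb{N}^d\setminus\{0\}$. Let $\iota_A,\iota_S:\mathcal{D}'(\mathbb{R}^d)\to\mathcal{G}(\mathbb{R}^d)$ be the two embeddings constructed (as described in the context) from this same $\rho$. Then $\iota_A=\iota_S$.
   Context: **Colombeau algebra.** For an open set $\Omega\subset\mathbb{R}^d$, a compact $K\Subset\Omega$ and $l\in\mathbb{N}$, put $p_{K,l}(f)=\sup_{|\alpha|\le l,\,x\in K}|\partial^\alpha f(x)|$ for $f\in C^\infty(\Omega)$ (complex-valued). Let $\mathcal{F}(C^\infty(\Omega))$ be the set of nets $(f_\varepsilon)_\varepsilon\in C^\infty(\Omega)^{(0,1]}$ such that for all $l\in\mathbb{N}$ and $K\Subset\Omega$ there is $q\in\mathbb{N}$ with $p_{K,l}(f_\varepsilon)=o(\varepsilon^{-q})$ as $\varepsilon\to0$, and $\mathcal{N}(C^\infty(\Omega))$ the set of nets such that for all $l\in\mathbb{N}$, $K\Subset\Omega$ and $p\in\mathbb{N}$, $p_{K,l}(f_\varepsilon)=o(\varepsilon^{p})$ as $\varepsilon\to0$. Then $\mathcal{G}(\Omega)=\mathcal{F}(C^\infty(\Omega))/\mathcal{N}(C^\infty(\Omega))$; $\Omega\mapsto\mathcal{G}(\Omega)$ is a sheaf of algebras on $\mathbb{R}^d$. **Mollifiers.** $\rho_\varepsilon(x)=\varepsilon^{-d}\rho(x/\varepsilon)$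 for $\varepsilon\in(0,1]$. Fix $\chi\in\mathcal{D}(\mathbb{R}^d)$ with $0\le\chi\le1$, $\chi\equiv1$ on $\overline{B(0,1)}$ and $\chi\equiv0$ on $\mathbb{R}^d\setminus B(0,2)$. For $\varepsilon\in(0,1)$, $\theta_\varepsilon(x)=\rho_\varepsilon(x)\,\chi(x|\ln\varepsilon|)$, so $\theta_\varepsilon\in\mathcal{D}(\mathbb{R}^d)$. **The embedding $\iota_S$.** $\iota_S(T)=(T*\theta_\varepsilon)_\varepsilon+\mathcal{N}(C^\infty(\mathbb{R}^d))$ for $T\in\mathcal{D}'(\mathbb{R}^d)$, where the term of the net at the single index $\varepsilon=1$ is set to be $0$ (its value does not affect the class). **The embedding $\iota_A$.** Let $\iota_0:\mathcal{E}'(\mathbb{R}^d)\to\mathcal{G}(\mathbb{R}^d)$, $\iota_0(T)=(T*\rho_\varepsilon)_\varepsilon+\mathcal{N}(C^\infty(\mathbb{R}^d))$. Fix a locally finite open covering $(\Omega_\lambda)_{\lambda\in\Lambda}$ of $\mathbb{R}^d$ with each $\overline{\Omega}_\lambda$ compact, and functions $\psi_\lambda\in\mathcal{D}(\mathbb{R}^d)$ with $0\le\psi_\lambda\le1$ and $\psi_\lambda\equiv1$ on a neighborhood of $\overline{\Omega}_\lambda$. Define $\iota_\lambda:\mathcal{D}'(\mathbb{R}^d)\to\mathcal{G}(\Omega_\lambda)$ by $\iota_\lambda(T)=\iota_0(\psi_\lambda T)|_{\Omega_\lambda}$. The family $(\iota_\lambda)_\lambda$ is coherent (i.e. $\iota_\lambda(T)$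 and $\iota_\mu(T)$ agree on $\Omega_\lambda\cap\Omega_\mu$), and $\iota_A:\mathcal{D}'(\mathbb{R}^d)\to\mathcal{G}(\mathbb{R}^d)$ is the unique map with $\iota_A(T)|_{\Omega_\lambda}=\iota_\lambda(T)$ for all $\lambda\in\Lambda$ and all $T$. It is known that $\iota_A$ does not depend on the choice of $(\Omega_\lambda)$ and $(\psi_\lambda)$. *)

(* Defs.v *)
From HB Require Import structures.
From mathcomp Require Import all_boot all_order all_algebra.
From mathcomp Require Import all_classical all_reals all_analysis.
From mathcomp Require Import complex ring_quotient ring lra.
Set Implicit Arguments. Unset Strict Implicit. Unset Printing Implicit Defensive.
Import Order.TTheory GRing.Theory Num.Theory.
Import numFieldNormedType.Exports.
Import Normc.
Local Open Scope classical_set_scope.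
Local Open Scope ring_scope.
Local Open Scope complex_scope.

(* R^d is ['rV[R]_d] for a [realType] R, and C is [R[i]]. A function on an open
   set is represented by a total function whose values elsewhere are ignored. *)

Section Derivatives.
Context {R : realType} {d : nat}.
Local Notation E := 'rV[R]_d.
Implicit Types (f g h : E -> R[i]) (x y v : E) (A : set E) (i : 'I_d)
  (w u : seq 'I_d) (a : {ffun 'I_d -> nat}).

Definition ccontinuous_at f x :=
  {for x, continuous (@complex.Re R \o f)} /\ {for x, continuous (@complex.Im R \o f)}.

Definition cderivable f x v :=
  derivable (@complex.Re R \o f) x v /\ derivable (@complex.Im R \o f) x v.

Definition partial i f : E -> R[i] := fun x =>
  'D_(delta_mx 0 i) (@complex.Re R \o f) x +i* 'D_(delta_mx 0 i) (@complex.Im R \o f) x.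

Definition partials w f := foldr partial f w.

(* All iterated partial derivatives exist and are continuous at the points of [A]. *)
Definition smooth_on A f := forall w x, A x ->
  ccontinuous_at (partials w f) x /\
  forall i, cderivable (partials w f) x (delta_mx 0 i).

Definition mdegree a := (\sum_i a i)%N.

(* The multi-index [a] as a list of directions, so that [mderive a] is the
   partial derivative of multi-index [a], in a fixed order of the variables. *)
Definition mword a := flatten [seq nseq (a i) i | i <- enum 'I_d].

Definition mderive a f := partials (mword a) f.

Definition seminorm (K : set E) (l : nat) f : R :=
  sup [set normc (mderive a f x) | a in [set a | (mdegree a <= l)%N] & x in K].

End Derivatives.

Section DerivativesTheory.
Context {R : realType} {d : nat}.
Local Notation E := 'rV[R]_d.
Implicit Types (f g h : E -> R[i]) (x y v : E) (A : set E) (i : 'I_d)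
  (w u : seq 'I_d) (a : {ffun 'I_d -> nat}).

Lemma ReD (z t : R[i]) : complex.Re (z + t) = complex.Re z + complex.Re t.
Proof. by case: z t => [? ?] [? ?]. Qed.
Lemma ImD (z t : R[i]) : complex.Im (z + t) = complex.Im z + complex.Im t.
Proof. by case: z t => [? ?] [? ?]. Qed.
Lemma ReM (z t : R[i]) : complex.Re (z * t) = complex.Re z * complex.Re t - complex.Im z * complex.Im t.
Proof. by case: z t => [? ?] [? ?]. Qed.
Lemma ImM (z t : R[i]) : complex.Im (z * t) = complex.Re z * complex.Im t + complex.Im z * complex.Re t.
Proof. by case: z t => [? ?] [? ?]. Qed.
Lemma complexE (z : R[i]) : z = complex.Re z +i* complex.Im z. Proof. by case: z. Qed.

Lemma comp_ReD f g : @complex.Re R \o (f + g) = (@complex.Re R \o f) + (@complex.Re R \o g).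
Proof. by apply/funext => x /=; rewrite !fctE ReD. Qed.
Lemma comp_ImD f g : @complex.Im R \o (f + g) = (@complex.Im R \o f) + (@complex.Im R \o g).
Proof. by apply/funext => x /=; rewrite !fctE ImD. Qed.
Lemma comp_ReM f g : @complex.Re R \o (f * g) =
  (@complex.Re R \o f) * (@complex.Re R \o g) - (@complex.Im R \o f) * (@complex.Im R \o g).
Proof. by apply/funext => x /=; rewrite !fctE ReM. Qed.
Lemma comp_ImM f g : @complex.Im R \o (f * g) =
  (@complex.Re R \o f) * (@complex.Im R \o g) + (@complex.Im R \o f) * (@complex.Re R \o g).
Proof. by apply/funext => x /=; rewrite !fctE ImM. Qed.

Lemma ccontinuousD f g x :
  ccontinuous_at f x -> ccontinuous_at g x -> ccontinuous_at (f + g) x.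
Proof.
move=> [fr fi] [gr gi]; rewrite /ccontinuous_at comp_ReD comp_ImD.
split; [exact: continuousD fr gr|exact: continuousD fi gi].
Qed.

Lemma ccontinuousM f g x :
  ccontinuous_at f x -> ccontinuous_at g x -> ccontinuous_at (f * g) x.
Proof.
move=> [fr fi] [gr gi]; rewrite /ccontinuous_at comp_ReM comp_ImM.
split.
  exact: continuousB (continuousM fr gr) (continuousM fi gi).
exact: continuousD (continuousM fr gi) (continuousM fi gr).
Qed.

Lemma cderivableD f g x v :
  cderivable f x v -> cderivable g x v -> cderivable (f + g) x v.
Proof.
move=> [fr fi] [gr gi]; rewrite /cderivable comp_ReD comp_ImD.
split; [exact: derivableD fr gr|exact: derivableD fi gi].
Qed.

Lemma cderivableM f g x v :
  cderivable f x v -> cderivable g x v -> cderivable (f * g) x v.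
Proof.
move=> [fr fi] [gr gi]; rewrite /cderivable comp_ReM comp_ImM.
split.
  exact: derivableB (derivableM fr gr) (derivableM fi gi).
exact: derivableD (derivableM fr gi) (derivableM fi gr).
Qed.

Lemma partialD i f g x :
  cderivable f x (delta_mx 0 i) -> cderivable g x (delta_mx 0 i) ->
  partial i (f + g) x = partial i f x + partial i g x.
Proof.
move=> [fr fi] [gr gi]; rewrite /partial comp_ReD comp_ImD.
by rewrite (deriveD fr gr) (deriveD fi gi).
Qed.

Lemma leibniz_complex (z t : R[i]) (zr zi tr ti : R) :
  (complex.Re z *: tr + complex.Re t *: zr -
    (complex.Im z *: ti + complex.Im t *: zi)) +i*
  ((complex.Re z *: ti + complex.Im t *: zr) +
    (complex.Im z *: tr + complex.Re t *: zi)) =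
  (zr +i* zi) * t + z * (tr +i* ti).
Proof.
case: z t => [a b] [a' b']; apply/eqP; rewrite eq_complex /= /GRing.scale/=.
by apply/andP; split; apply/eqP; ring.
Qed.

Lemma partialM i f g x :
  cderivable f x (delta_mx 0 i) -> cderivable g x (delta_mx 0 i) ->
  partial i (f * g) x = partial i f x * g x + f x * partial i g x.
Proof.
move=> [fr fi] [gr gi]; rewrite /partial comp_ReM comp_ImM.
rewrite (deriveB (derivableM fr gr) (derivableM fi gi)).
rewrite (deriveD (derivableM fr gi) (derivableM fi gr)).
rewrite (deriveM fr gr) (deriveM fi gi) (deriveM fr gi) (deriveM fi gr).
exact: leibniz_complex.
Qed.

Lemma partial_cst i (c : R[i]) : partial i (cst c) = 0 :> (E -> R[i]).
Proof.
apply/funext => x; rewrite /partial.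
have -> : @complex.Re R \o cst c = cst (complex.Re c) :> (E -> R) by [].
have -> : @complex.Im R \o cst c = cst (complex.Im c) :> (E -> R) by [].
by rewrite !derive_cst.
Qed.

Lemma partials_rcons w i f : partials (rcons w i) f = partials w (partial i f).
Proof. by rewrite /partials foldr_rcons. Qed.

Lemma near_partial i f g x :
  (\forall y \near x, f y = g y) -> partial i f x = partial i g x.
Proof.
move=> fg; rewrite /partial; congr (_ +i* _); apply: near_eq_derive;
  by near=> y => /=; rewrite (near fg y).
Unshelve. all: by end_near. Qed.

Lemma near_ccontinuous f g x : (\forall y \near x, f y = g y) ->
  ccontinuous_at f x -> ccontinuous_at g x.
Proof.
move=> fg [fr fi]; have fgx : f x = g x := nbhs_singleton fg.
split; rewrite /prop_for /continuous_at /= -fgx.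
- apply: cvg_trans fr; apply: (@near_eq_cvg _ _ (nbhs x)).
  by near=> y => /=; rewrite (near fg y).
- apply: cvg_trans fi; apply: (@near_eq_cvg _ _ (nbhs x)).
  by near=> y => /=; rewrite (near fg y).
Unshelve. all: by end_near. Qed.

Lemma near_cderivable f g x v : (\forall y \near x, f y = g y) ->
  cderivable f x v -> cderivable g x v.
Proof.
move=> fg [fr fi]; split.
- by apply: near_eq_derivable fr; near=> y => /=; rewrite (near fg y).
- by apply: near_eq_derivable fi; near=> y => /=; rewrite (near fg y).
Unshelve. all: by end_near. Qed.

Lemma partials_eq A f g w : open A -> {in A, f =1 g} ->
  {in A, partials w f =1 partials w g}.
Proof.
move=> oA fg; elim: w => [//|i w IH] x xA; apply: near_partial.
by apply: filterS (open_nbhs_nbhs (conj oA (set_mem xA))) => y yA; apply/IH/mem_set.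
Qed.

Lemma near_open A f g x : open A -> A x -> {in A, f =1 g} ->
  \forall y \near x, f y = g y.
Proof.
move=> oA Ax fg.
by apply: filterS (open_nbhs_nbhs (conj oA Ax)) => y yA; apply/fg/mem_set.
Qed.

Lemma smooth_eq A f g : open A -> {in A, f =1 g} -> smooth_on A f ->
  smooth_on A g.
Proof.
move=> oA fg sf w x Ax; have [cf df] := sf w x Ax.
have fgw := near_open oA Ax (partials_eq w oA fg).
by split=> [|i]; [apply: near_ccontinuous cf|apply: near_cderivable (df i)].
Qed.

Lemma smooth_partial A f i : smooth_on A f -> smooth_on A (partial i f).
Proof. by move=> sf w x Ax; rewrite -partials_rcons; exact: sf. Qed.

Lemma smooth_cderivable A f i x : smooth_on A f -> A x ->
  cderivable f x (delta_mx 0 i).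
Proof. by move=> sf /(sf [::])[_]; exact. Qed.

Lemma smooth_partials A f w : smooth_on A f -> smooth_on A (partials w f).
Proof. by move=> sf; elim: w => [//|i w]; exact: smooth_partial. Qed.

Fixpoint Ck A n f := if n is n'.+1 then
    (forall x, A x -> ccontinuous_at f x) /\ forall i, (forall x, A x -> cderivable f x (delta_mx 0 i)) /\
                         Ck A n' (partial i f)
  else forall x, A x -> ccontinuous_at f x.

Lemma CkW A n f : Ck A n.+1 f -> Ck A n f.
Proof.
by elim: n f => [|n IH] f [] // f0 fS; split=> // i; have [? /IH] := fS i.
Qed.

Lemma Ck_eq A n f g : open A -> {in A, f =1 g} -> Ck A n f -> Ck A n g.
Proof.
move=> oA; elim: n f g => [|n IH] f g fg.
  by move=> cf x Ax; apply: near_ccontinuous (cf x Ax); exact: near_open fg.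
move=> [f0 fS]; split.
  by move=> x Ax; apply: near_ccontinuous (f0 x Ax); exact: near_open fg.
move=> i; have [df cf] := fS i; split.
  by move=> x Ax; apply: near_cderivable (df x Ax); exact: near_open fg.
by apply: IH cf => x xA; exact: (partials_eq [:: i] oA fg).
Qed.

Lemma CkD A n f g : open A -> Ck A n f -> Ck A n g -> Ck A n (f + g).
Proof.
move=> oA; elim: n f g => [|n IH] f g.
  by move=> cf cg x Ax; apply: ccontinuousD; [exact: cf|exact: cg].
move=> [f0 fS] [g0 gS]; split.
  by move=> x Ax; apply: ccontinuousD; [exact: f0|exact: g0].
move=> i; have [df cf] := fS i; have [dg cg] := gS i; split.
  by move=> x Ax; apply: cderivableD; [exact: df|exact: dg].
apply: Ck_eq (IH _ _ cf cg) => // x /set_mem Ax.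
by rewrite partialD//; [exact: df|exact: dg].
Qed.

Lemma CkM A n f g : open A -> Ck A n f -> Ck A n g -> Ck A n (f * g).
Proof.
move=> oA; elim: n f g => [|n IH] f g.
  by move=> cf cg x Ax; apply: ccontinuousM; [exact: cf|exact: cg].
move=> fn gn; have [f0 fS] := fn; have [g0 gS] := gn; split.
  by move=> x Ax; apply: ccontinuousM; [exact: f0|exact: g0].
move=> i; have [df cf] := fS i; have [dg cg] := gS i; split.
  by move=> x Ax; apply: cderivableM; [exact: df|exact: dg].
apply: (@Ck_eq _ _ (partial i f * g + f * partial i g)) => //.
  by move=> x /set_mem Ax; rewrite partialM//; [exact: df|exact: dg].
by apply: CkD => //; apply: IH => //; exact: CkW.
Qed.

Lemma Ck_cst A n (c : R[i]) : Ck A n (cst c).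
Proof.
have c0 (k : R[i]) x : ccontinuous_at (cst k : E -> R[i]) x.
  split; [exact: (@cst_continuous E R (complex.Re k) x)|].
  exact: (@cst_continuous E R (complex.Im k) x).
elim: n c => [|n IH] c; first by move=> x _; exact: c0.
split; first by move=> x _; exact: c0.
by move=> i; split; [move=> x _; split; exact: derivable_cst|rewrite partial_cst; exact: (IH 0)].
Qed.

Lemma smooth_onP A f : smooth_on A f <-> forall n, Ck A n f.
Proof.
split=> [sf n|cf w].
  elim: n f sf => [|n IH] f sf; first by move=> x /(sf [::])[].
  split; first by move=> x /(sf [::])[].
  by move=> i; split; [move=> x; exact: smooth_cderivable|exact/IH/smooth_partial].
elim/last_ind: w f cf => [|w i IH] f cf x Ax.
  by split; [exact: (cf 0%N)|move=> i; exact: ((cf 1%N).2 i).1].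
by rewrite partials_rcons; apply: IH => // n; exact: ((cf n.+1).2 i).2.
Qed.

Lemma smooth_cst A (c : R[i]) : smooth_on A (cst c).
Proof. by apply/smooth_onP => n; exact: Ck_cst. Qed.

Lemma smoothD A f g : open A -> smooth_on A f -> smooth_on A g ->
  smooth_on A (f + g).
Proof.
by move=> oA /smooth_onP sf /smooth_onP sg; apply/smooth_onP => n; exact: CkD.
Qed.

Lemma smoothM A f g : open A -> smooth_on A f -> smooth_on A g ->
  smooth_on A (f * g).
Proof.
by move=> oA /smooth_onP sf /smooth_onP sg; apply/smooth_onP => n; exact: CkM.
Qed.

Lemma scaleE (c : R[i]) f : c *: f = cst c * f.
Proof. by []. Qed.

Lemma smoothZ A (c : R[i]) f : open A -> smooth_on A f -> smooth_on A (c *: f).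
Proof. move=> oA sf; exact: (smoothM oA (@smooth_cst A c) sf). Qed.

Lemma partialsD A w f g : open A -> smooth_on A f -> smooth_on A g ->
  {in A, partials w (f + g) =1 partials w f + partials w g}.
Proof.
move=> oA sf sg; elim: w => [//|i w IH] x xA; have Ax := set_mem xA.
rewrite /= (near_partial i (near_open oA Ax IH)) partialD//.
- by case: (sf w x Ax).
- by case: (sg w x Ax).
Qed.

Lemma partialsZ A w (c : R[i]) f : open A -> smooth_on A f ->
  {in A, partials w (c *: f) =1 c *: partials w f}.
Proof.
move=> oA sf; elim: w => [//|i w IH] x xA; have Ax := set_mem xA.
rewrite /= (near_partial i (near_open oA Ax IH)) scaleE partialM.
- by rewrite partial_cst mul0r add0r.
- by split; exact: derivable_cst.
- by case: (sf w x Ax).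
Qed.

Lemma partialsB A w f g : open A -> smooth_on A f -> smooth_on A g ->
  {in A, partials w (f - g) =1 partials w f - partials w g}.
Proof.
move=> oA sf sg x xA; rewrite -scaleN1r (partialsD w oA sf (smoothZ (-1) oA sg))//.
by rewrite !fctE (partialsZ w (-1) oA sg)// !fctE scaleN1r.
Qed.

End DerivativesTheory.

Section Seminorms.
Context {R : realType} {d : nat}.
Local Notation E := 'rV[R]_d.
Implicit Types (f g h : E -> R[i]) (x y v : E) (A K : set E) (i : 'I_d)
  (w u : seq 'I_d) (a b : {ffun 'I_d -> nat}).

Lemma normcD_le (z t : R[i]) : normc (z + t) <= normc z + normc t.
Proof. exact: le_normcD. Qed.

Lemma normcB_le (z t : R[i]) : normc (z - t) <= normc z + normc t.
Proof. by rewrite (le_trans (normcD_le _ _))// normcN. Qed.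

Lemma normc_ge0 (z : R[i]) : 0 <= normc z.
Proof. by case: z => s t /=; exact: sqrtr_ge0. Qed.

Lemma normc_le (z : R[i]) : normc z <= `|complex.Re z| + `|complex.Im z|.
Proof.
case: z => s t /=; rewrite -(@ger0_norm _ (`|s| + `|t|)) ?addr_ge0//.
rewrite -sqrtr_sqr ler_sqrt ?sqr_ge0// sqrrD !real_normK ?num_real//.
by rewrite addrAC lerDl mulrn_wge0// mulr_ge0.
Qed.

Lemma count_mword a i : count_mem i (mword a) = a i.
Proof.
rewrite /mword count_flatten -map_comp sumnE big_map big_enum/=.
rewrite (bigD1 i)//= count_nseq/= eqxx mul1n big1 ?addn0// => j ji.
by rewrite count_nseq/= (negbTE ji).
Qed.

Lemma size_mword a : size (mword a) = mdegree a.
Proof.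
rewrite /mword size_flatten /shape -map_comp sumnE big_map big_enum/=.
by apply: eq_bigr => j _; rewrite /= size_nseq.
Qed.

Let leI : rel 'I_d := relpre val leq.
Let leI_trans : transitive leI. Proof. by move=> ? ? ?; exact: leq_trans. Qed.
Let leI_anti : antisymmetric leI.
Proof. by move=> i j ij; apply/val_inj/anti_leq. Qed.

Lemma sorted_mword a : sorted leI (mword a).
Proof.
have : pairwise leI (enum 'I_d).
  by rewrite -sorted_pairwise// /leI -sorted_map val_enum_ord iota_sorted.
rewrite sorted_pairwise// /mword; elim: (enum _) => [//|i s IH] /= /andP[il s_].
rewrite pairwise_cat IH// andbT; apply/andP; split.
  apply/allrelP => j k /nseqP[-> _] /flattenP[_ /mapP[m ms ->]] /nseqP[-> _].
  exact: (allP il).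
elim: (a i) => [//|n IHn] /=; rewrite IHn andbT.
by apply/allP => j /nseqP[-> _]; rewrite /leI/=.
Qed.

Lemma subseq_mword a u : subseq u (mword a) ->
  exists2 b, mword b = u & (mdegree b <= mdegree a)%N.
Proof.
move=> ua; pose b := [ffun i => count_mem i u].
have bu : mword b = u.
  apply: (sorted_eq leI_trans leI_anti) (sorted_mword _) _ _.
    exact: subseq_sorted ua (sorted_mword a).
  by apply/allP => i _ /=; rewrite count_mword ffunE.
by exists b => //; rewrite -!size_mword bu size_subseq.
Qed.

Lemma ccontinuous_bounded K f : compact K ->
  (forall x, K x -> ccontinuous_at f x) ->
  exists2 M, 0 <= M & forall x, K x -> normc (f x) <= M.
Proof.
move=> cK cf.
have bound (p : E -> R) : (forall x, K x -> {for x, continuous p}) ->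
    exists2 M, 0 <= M & forall x, K x -> `|p x| <= M.
  move=> cp; have : {within K, continuous p}.
    by apply: continuous_in_subspaceT => x xK; apply/cp/set_mem.
  move=> /continuous_compact/(_ cK)/compact_bounded[M [_ HM]].
  exists (`|M| + 1); first by rewrite addr_ge0.
  move=> x Kx; apply: (HM (`|M| + 1)); last by exists x.
  by rewrite (le_lt_trans (ler_norm M))// ltrDl.
have [M1 M10 H1] := bound _ (fun x Kx => (cf x Kx).1).
have [M2 M20 H2] := bound _ (fun x Kx => (cf x Kx).2).
exists (M1 + M2); first exact: addr_ge0.
by move=> x Kx; rewrite (le_trans (normc_le _))// lerD ?H1 ?H2.
Qed.

Lemma smooth_bounded A K w f : compact K -> K `<=` A -> smooth_on A f ->
  exists2 M, 0 <= M & forall x, K x -> normc (partials w f x) <= M.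
Proof.
move=> cK KA sf; apply: (ccontinuous_bounded cK) => x Kx.
exact: (sf w x (KA x Kx)).1.
Qed.

Let semiset K l f :=
  [set normc (mderive a f x) | a in [set a | (mdegree a <= l)%N] & x in K].

Lemma seminorm_has_ubound A K l f : compact K -> K `<=` A -> smooth_on A f ->
  has_ubound (semiset K l f).
Proof.
move=> cK KA sf.
have /choice[M HM] (w : seq 'I_d) : exists M, 0 <= M /\
    forall x, K x -> normc (partials w f x) <= M.
  by have [M M0 ?] := smooth_bounded w cK KA sf; exists M.
exists (\sum_(k < l.+1) \sum_(t : k.-tuple 'I_d) M t).
move=> _ [a /= al [x Kx <-]].
have Ka : (size (mword a) < l.+1)%N by rewrite size_mword ltnS.
rewrite (bigD1 (Ordinal Ka))//= (bigD1 (in_tuple (mword a)))//=.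
rewrite -addrA (le_trans ((HM (mword a)).2 x Kx))// lerDl addr_ge0//.
  by apply: sumr_ge0 => t _; exact: (HM _).1.
by apply: sumr_ge0 => k _; apply: sumr_ge0 => t _; exact: (HM _).1.
Qed.

Lemma seminorm_ub A K l f a x : compact K -> K `<=` A -> smooth_on A f ->
  (mdegree a <= l)%N -> K x -> normc (mderive a f x) <= seminorm K l f.
Proof.
move=> cK KA sf al Kx; apply: ub_le_sup; last by exists a => //; exists x.
exact: seminorm_has_ubound sf.
Qed.

Lemma seminorm_le K l f M : 0 <= M ->
  (forall a x, (mdegree a <= l)%N -> K x -> normc (mderive a f x) <= M) ->
  seminorm K l f <= M.
Proof.
move=> M0 HM; rewrite /seminorm -/(semiset K l f); have [->|/set0P ne] := eqVneq (semiset K l f) set0.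
  by rewrite sup0.
by apply: ge_sup => // _ [a /= al [x Kx <-]]; exact: HM.
Qed.

Lemma seminorm_ge0 A K l f : compact K -> K `<=` A -> smooth_on A f ->
  0 <= seminorm K l f.
Proof.
move=> cK KA sf; have [K0|/set0P[x Kx]] := eqVneq K set0.
  rewrite /seminorm (_ : image2 _ _ _ = set0) ?sup0//.
  by rewrite -subset0 K0 => _ [a _ [x []]].
apply: le_trans (seminorm_ub (a := [ffun=> 0%N]) cK KA sf _ Kx) => //.
  exact: normc_ge0.
by rewrite /mdegree big1// => i _; rewrite ffunE.
Qed.

Lemma seminormB A K l f g : open A -> compact K -> K `<=` A ->
  smooth_on A f -> smooth_on A g ->
  seminorm K l (f - g) <= seminorm K l f + seminorm K l g.
Proof.
move=> oA cK KA sf sg; apply: seminorm_le.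
  by apply: addr_ge0; [exact: (seminorm_ge0 l cK KA sf)|
                       exact: (seminorm_ge0 l cK KA sg)].
move=> a x al Kx; rewrite /mderive (partialsB (mword a) oA sf sg); last first.
  exact/mem_set/KA.
apply: le_trans (normcB_le _ _) _; apply: lerD.
  exact: (seminorm_ub cK KA sf al Kx).
exact: (seminorm_ub cK KA sg al Kx).
Qed.

Lemma seminorm0 K l : seminorm K l (0 : E -> R[i]) = 0.
Proof.
have p0 w : partials w (0 : E -> R[i]) = 0.
  by elim: w => [//|i w /= ->]; exact: partial_cst.
apply/eqP; rewrite eq_le; apply/andP; split.
  by apply: seminorm_le => // a x _ _; rewrite /mderive p0 normc0.
have [K0|/set0P[x Kx]] := eqVneq (semiset K l 0) set0.
  by rewrite /seminorm -/(semiset K l 0) K0 sup0.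
apply: ub_le_sup; last first.
  case: Kx => b bl [y Ky _]; exists b => //; exists y => //.
  by rewrite /mderive p0 normc0.
by exists 0 => _ [b bl [y Ky <-]]; rewrite /mderive p0 normc0.
Qed.

Lemma leibniz_bound A K w f : open A -> compact K -> K `<=` A -> smooth_on A f ->
  exists2 c, 0 <= c & forall g, smooth_on A g -> forall x B, K x ->
    (forall u, subseq u w -> normc (partials u g x) <= B) ->
    normc (partials w (f * g) x) <= c * B.
Proof.
move=> oA cK KA; elim/last_ind: w f => [|w i IH] f sf.
  have [c c0 fc] := smooth_bounded [::] cK KA sf.
  exists c => // g sg x B Kx /(_ [::] isT) gB /=.
  by rewrite !fctE normcM ler_pM ?normc_ge0//; exact: fc.
have [c c0 fc] := IH _ (smooth_partial i sf).
have [c' c'0 fc'] := IH _ sf.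
exists (c + c'); first exact: addr_ge0.
move=> g sg x B Kx gB; have Ax := KA _ Kx.
have sfg : smooth_on A (partial i f * g).
  exact: (smoothM oA (smooth_partial i sf) sg).
have sfg' : smooth_on A (f * partial i g).
  exact: (smoothM oA sf (smooth_partial i sg)).
have E1 : {in A, partial i (f * g) =1 partial i f * g + f * partial i g}.
  move=> y /set_mem Ay; apply: partialM.
    exact: smooth_cderivable sf Ay.
  exact: smooth_cderivable sg Ay.
rewrite partials_rcons (partials_eq w oA E1); last exact/mem_set.
rewrite (partialsD w oA sfg sfg'); last exact/mem_set.
rewrite mulrDl; apply: le_trans (normcD_le _ _) _; apply: lerD.
  apply: fc => // u uw; apply: gB; exact: subseq_trans uw (subseq_rcons _ _).
apply: (fc' (partial i g) (smooth_partial i sg) x B Kx) => u uw.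
rewrite -partials_rcons; apply: gB.
by rewrite -!cats1 cat_subseq.
Qed.

Lemma seminormM A K l f : open A -> compact K -> K `<=` A -> smooth_on A f ->
  exists2 c, 0 <= c & forall g, smooth_on A g ->
    seminorm K l (f * g) <= c * seminorm K l g.
Proof.
move=> oA cK KA sf.
have /choice[c Hc] (w : seq 'I_d) : exists c, 0 <= c /\
    forall g, smooth_on A g -> forall x B, K x ->
    (forall u, subseq u w -> normc (partials u g x) <= B) ->
    normc (partials w (f * g) x) <= c * B.
  by have [c c0 ?] := leibniz_bound w oA cK KA sf; exists c.
pose C := \sum_(k < l.+1) \sum_(t : k.-tuple 'I_d) c t.
have C0 : 0 <= C.
  by apply: sumr_ge0 => k _; apply: sumr_ge0 => t _; exact: (Hc _).1.
exists C => // g sg; have pg0 := seminorm_ge0 l cK KA sg.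
apply: seminorm_le; first exact: mulr_ge0.
move=> a x al Kx.
have Ka : (size (mword a) < l.+1)%N by rewrite size_mword ltnS.
apply: (@le_trans _ _ (c (mword a) * seminorm K l g)).
  apply: (Hc _).2 => // u /subseq_mword[b <- ba].
  exact: (seminorm_ub cK KA sg (leq_trans ba al) Kx).
apply: ler_wpM2r => //.
rewrite /C (bigD1 (Ordinal Ka))//= (bigD1 (in_tuple (mword a)))//=.
rewrite -addrA lerDl addr_ge0//.
  by apply: sumr_ge0 => t _; exact: (Hc _).1.
by apply: sumr_ge0 => k _; apply: sumr_ge0 => t _; exact: (Hc _).1.
Qed.

End Seminorms.

Section Affine.
Context {R : realType} {d : nat}.
Local Notation E := 'rV[R]_d.
Implicit Types (f g h : E -> R[i]) (x y v : E) (A K : set E) (i : 'I_d)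
  (w u : seq 'I_d) (c : R).

Lemma derive_line (g : E -> R) x v :
  'D_v g x = 'D_1 (fun t : R => g (t *: v + x)) 0.
Proof.
have e : (fun t : R => t^-1 *: ((g \o shift x) (t *: v) - g x)) =
    (fun t => t^-1 *: (((fun t : R => g (t *: v + x)) \o shift 0) (t *: 1) -
                       g (0 *: v + x))).
  by apply/funext => t /=; rewrite scale0r add0r addr0 /GRing.scale/= mulr1.
by rewrite /derive e.
Qed.

Lemma derive_affine (g : E -> R) x c y v : derivable g (x + c *: y) v ->
  derivable (fun z => g (x + c *: z)) y v /\
  'D_v (fun z => g (x + c *: z)) y = c * 'D_v g (x + c *: y).
Proof.
move=> /derivable1P; set k := (fun t : R => _) => dk.
have kE : (fun t : R => g (x + c *: (t *: v + y))) = k \o ( *%R c).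
  apply/funext => t; rewrite /k /=; congr g.
  by rewrite scalerDr scalerA addrA (addrC x) -addrA.
have dc : derivable ( *%R c : R -> R) 0 1.
  apply: derivableM; [exact: derivable_cst|exact: derivable_id].
have dk' : derivable k (c * 0) 1 by rewrite mulr0; exact: dk.
split.
  apply/derivable1P; rewrite kE; apply/derivable1_diffP.
  apply: differentiable_comp; first by move/derivable1_diffP : dc; exact.
  by move/derivable1_diffP : dk'; exact.
rewrite derive_line kE -derive1E (derive1_comp dc dk') mulr0 [in X in X * _]derive1E.
have did : derivable (id : R -> R) 0 1 by exact: derivable_id.
have -> : ( *%R c : R -> R)^`()%classic 0 = c.
  by have := derive1Ml c did; rewrite derive1_id mulr1.
by rewrite -derive_line mulrC.
Qed.

Definition affine (x : E) (c : R) f : E -> R[i] := fun y => f (x + c *: y).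

Lemma continuous_affine x c : continuous (fun y : E => x + c *: y).
Proof.
move=> y; pose f := @cst E E x; pose g := fun z : E => c *: z.
have cf : {for y, continuous f} by exact: cst_continuous.
have cg : {for y, continuous g} by exact: scaler_continuous.
exact: (continuousD cf cg).
Qed.

Lemma smooth_affine x c f : smooth_on setT f -> smooth_on setT (affine x c f).
Proof.
move=> /smooth_onP sf; apply/smooth_onP => n.
elim: n f sf => [|n IH] f sf.
  move=> y _; have [cr ci] := sf 0%N (x + c *: y) I.
  split; [exact: (continuous_comp (@continuous_affine x c y) cr)|].
  exact: (continuous_comp (@continuous_affine x c y) ci).
have [f0 fS] := sf 1%N.
split=> [y _|i].
  have [cr ci] := f0 (x + c *: y) I.
  split; [exact: (continuous_comp (@continuous_affine x c y) cr)|].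
  exact: (continuous_comp (@continuous_affine x c y) ci).
have [df _] := fS i; split=> [y _|].
  have [dr di] := df (x + c *: y) I.
  by split; [exact: (derive_affine dr).1|exact: (derive_affine di).1].
have -> : partial i (affine x c f) = cst c%:C * affine x c (partial i f).
  apply/funext => y; have [dr di] := df (x + c *: y) I.
  rewrite /partial (derive_affine dr).2 (derive_affine di).2.
  by rewrite !fctE /affine; apply/eqP; rewrite eq_complex/= !mul0r subr0 addr0 !eqxx.
apply: (CkM openT (Ck_cst _ _ _)); apply: IH => m.
exact: ((sf m.+1).2 i).2.
Qed.

Definition supp f := closure [set x | f x != 0].

Lemma supp_sub K f : compact K -> (forall x, ~ K x -> f x = 0) -> supp f `<=` K.
Proof.
move=> cK f0; have clK : closed K by exact: compact_closed (@norm_hausdorff _ _) cK.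
rewrite [X in _ `<=` X](closure_id K).1//; apply: closureS => x /= fx.
by apply: contrapT => /f0 /eqP; exact/negP.
Qed.

Lemma compact_supp K f : compact K -> (forall x, ~ K x -> f x = 0) ->
  compact (supp f).
Proof.
move=> cK f0; apply: subclosed_compact cK (supp_sub cK f0); exact: closed_closure.
Qed.

Lemma supp0 f x : ~ supp f x -> f x = 0.
Proof.
move=> sx; apply/eqP; apply: contrapT => /negP fx; apply: sx.
exact: subset_closure.
Qed.

Lemma compact_supp_affine x c f : c != 0 -> compact (supp f) ->
  compact (supp (affine x c f)).
Proof.
move=> c0 cf.
have cK : compact [set - (c^-1 *: x) + c^-1 *: z | z in supp f].
  apply: continuous_compact cf.
  by apply: continuous_subspaceT; exact: continuous_affine.
apply: compact_supp cK _ => y Ky; apply: (@supp0 f (x + c *: y)) => fy; apply: Ky.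
exists (x + c *: y) => //.
by rewrite scalerDr scalerA mulVf// scale1r addKr.
Qed.

End Affine.

Section FunctionSpaces.
Context {R : realType} {d : nat}.
Local Notation E := 'rV[R]_d.
Implicit Types (f g : E -> R[i]) (x y : E).

Definition smooth_pred : {pred E -> R[i]} := fun f => `[< smooth_on setT f >].

Definition test_pred : {pred E -> R[i]} :=
  fun f => `[< smooth_on setT f /\ compact (supp f) >].

Lemma smooth_submod_closed : submod_closed smooth_pred.
Proof.
split=> [|c f g /asboolP sf /asboolP sg].
  exact/asboolP/(@smooth_cst R d setT 0).
apply/asboolP; exact: (smoothD openT (smoothZ c openT sf) sg).
Qed.

Lemma test_submod_closed : submod_closed test_pred.
Proof.
split=> [|c f g /asboolP[sf cf] /asboolP[sg cg]]; apply/asboolP; split.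
- exact: (@smooth_cst R d setT 0).
- by apply: (@compact_supp _ _ set0) => //; exact: compact0.
- exact: (smoothD openT (smoothZ c openT sf) sg).
- apply: compact_supp (compactU cf cg) _ => x /not_orP[fx gx].
  by rewrite !fctE (supp0 fx) (supp0 gx) scaler0 addr0.
Qed.

HB.instance Definition _ := GRing.isSubmodClosed.Build R[i] (E -> R[i])
  smooth_pred smooth_submod_closed.
HB.instance Definition _ := GRing.isSubmodClosed.Build R[i] (E -> R[i])
  test_pred test_submod_closed.

End FunctionSpaces.

Record smoothfun (R : realType) (d : nat) := SmoothFun {
  smoothfun_fun :> 'rV[R]_d -> R[i];
  _ : smoothfun_fun \in smooth_pred }.
Record testfun (R : realType) (d : nat) := TestFun {
  testfun_fun :> 'rV[R]_d -> R[i];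
  _ : testfun_fun \in test_pred }.

Section FunctionSpacesTheory.
Context {R : realType} {d : nat}.
Local Notation E := 'rV[R]_d.

HB.instance Definition _ := [isSub for @smoothfun_fun R d].
HB.instance Definition _ := [Choice of smoothfun R d by <:].
HB.instance Definition _ := [SubChoice_isSubLmodule of smoothfun R d by <:].
HB.instance Definition _ := [isSub for @testfun_fun R d].
HB.instance Definition _ := [Choice of testfun R d by <:].
HB.instance Definition _ := [SubChoice_isSubLmodule of testfun R d by <:].

Lemma smoothfunP (f : smoothfun R d) : smooth_on setT f.
Proof. by case: f => f /= /asboolP. Qed.

Lemma testfunP (f : testfun R d) : smooth_on setT f.
Proof. by case: f => f /= /asboolP[]. Qed.

Lemma testfun_compact (f : testfun R d) : compact (supp f).
Proof. by case: f => f /= /asboolP[]. Qed.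

Lemma testM_subproof (psi : testfun R d) (phi : smoothfun R d) :
  (psi : E -> R[i]) * (phi : E -> R[i]) \in test_pred.
Proof.
apply/asboolP; split; first exact: smoothM openT (testfunP psi) (smoothfunP phi).
apply: compact_supp (@testfun_compact psi) _ => x px.
by rewrite !fctE (supp0 px) mul0r.
Qed.
Definition testM psi phi : testfun R d := TestFun (testM_subproof psi phi).

Lemma reflE (x : E) (f : E -> R[i]) : (fun y => f (x - y)) = affine x (-1) f.
Proof. by apply/funext => y; rewrite /affine scaleN1r. Qed.

Lemma smooth_refl_subproof x (phi : smoothfun R d) :
  (fun y => phi (x - y)) \in smooth_pred.
Proof. by rewrite reflE; exact/asboolP/smooth_affine/smoothfunP. Qed.
Definition smooth_refl x phi : smoothfun R d := SmoothFun (smooth_refl_subproof x phi).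

Lemma test_refl_subproof x (phi : testfun R d) :
  (fun y => phi (x - y)) \in test_pred.
Proof.
rewrite reflE; apply/asboolP; split; first exact/smooth_affine/testfunP.
by apply: compact_supp_affine; [rewrite oppr_eq0 oner_eq0|exact: testfun_compact].
Qed.
Definition test_refl x phi : testfun R d := TestFun (test_refl_subproof x phi).

End FunctionSpacesTheory.

(* Continuity on D(R^d) is stated as a seminorm estimate on each compact set. *)
Record distribution (R : realType) (d : nat) := Distribution {
  distribution_fun :> {scalar testfun R d};
  _ : forall K : set 'rV[R]_d, compact K -> exists (l : nat) (c : R),
    forall phi : testfun R d, supp phi `<=` K ->
      normc (distribution_fun phi) <= c * seminorm K l phi }.

(* E'(R^d), as the dual of C^oo(R^d). *)
Record cdistribution (R : realType) (d : nat) := CDistribution {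
  cdistribution_fun :> {scalar smoothfun R d};
  _ : exists (K : set 'rV[R]_d) (l : nat) (c : R), compact K /\
    forall phi : smoothfun R d,
      normc (cdistribution_fun phi) <= c * seminorm K l phi }.

Section DistributionTheory.
Context {R : realType} {d : nat}.
Local Notation E := 'rV[R]_d.
Implicit Types (T : distribution R d) (psi : testfun R d).

Definition mulD_fun psi T (phi : smoothfun R d) : R[i] := T (testM psi phi).

Lemma mulD_scalar psi T : scalar (mulD_fun psi T).
Proof.
move=> c f g; rewrite /mulD_fun -linearP; congr (T _); apply/val_inj/funext => x /=.
by rewrite !fctE /GRing.scale/= mulrDr mulrCA.
Qed.

HB.instance Definition _ psi T :=
  GRing.isLinear.Build R[i] (smoothfun R d) R[i] *%R (mulD_fun psi T)
    (mulD_scalar psi T).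

Lemma mulD_continuous psi T : exists K l c, compact K /\
  forall phi : smoothfun R d, normc (mulD_fun psi T phi) <= c * seminorm K l phi.
Proof.
have cK := @testfun_compact _ _ psi; have sp := testfunP psi.
case: T => T HT; rewrite /mulD_fun/=; have [l [c Hc]] := HT _ cK.
have [c' c'0 Hc'] := @seminormM _ _ setT _ l _ openT cK (fun _ _ => I) sp.
exists (supp psi), l, (`|c| * c'); split=> // phi.
have sphi := smoothfunP phi.
have p0 := seminorm_ge0 l cK (fun _ _ => I) (smoothM openT sp sphi).
apply: (le_trans (Hc (testM psi phi) _)).
  apply: supp_sub => // x px; by rewrite /testM/= !fctE (supp0 px) mul0r.
apply: (@le_trans _ _ (`|c| * seminorm (supp psi) l (testM psi phi))).
  by apply: ler_wpM2r => //; exact: ler_norm.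
by rewrite -mulrA; apply: ler_wpM2l => //; exact: Hc'.
Qed.

(* For phi in C^oo(R^d), <psi T, phi> = <T, psi phi> with psi phi in D(R^d). *)
Definition mulD psi T : cdistribution R d :=
  @CDistribution R d (mulD_fun psi T) (mulD_continuous psi T).

Definition conv T (phi : testfun R d) : E -> R[i] := fun x => T (test_refl x phi).

Definition cconv (S : cdistribution R d) (phi : smoothfun R d) : E -> R[i] :=
  fun x => S (smooth_refl x phi).

End DistributionTheory.

Record opens (R : realType) (d : nat) := Opens {
  opens_set :> set 'rV[R]_d;
  opensP : open opens_set }.
Arguments opensP {R d} Omega : rename.

Definition fullspace (R : realType) (d : nat) : opens R d := Opens openT.

Lemma sub_fullspace (R : realType) (d : nat) (Omega : opens R d) :
  Omega `<=` fullspace R d.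
Proof. by []. Qed.

Section Colombeau.
Context {R : realType} {d : nat}.
Local Notation E := 'rV[R]_d.

Implicit Types (Omega : opens R d) (f g : R -> E -> R[i]).

(* Nets are functions on all of [R], but only the indices in (0, 1] matter. *)
Definition moderate Omega f :=
  (forall e, 0 < e <= 1 -> smooth_on Omega (f e)) /\
  (forall (l : nat) K, compact K -> K `<=` Omega -> exists q : nat,
    (fun e => seminorm K l (f e)) =o_ (0^'+) (fun e : R => e ^- q)).

Definition negligible_net Omega f :=
  forall (l : nat) K, compact K -> K `<=` Omega -> forall p : nat,
    (fun e => seminorm K l (f e)) =o_ (0^'+) (fun e : R => e ^+ p).

Lemma near01 : \forall e \near (0 : R)^'+, 0 < e <= 1.
Proof.
near=> e; apply/andP; split; near: e; first exact: nbhs_right_gt.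
by near=> e; apply: ltW; near: e; apply: nbhs_right_lt; exact: ltr01.
Unshelve. all: by end_near. Qed.

Lemma smooth_netB Omega f g e : smooth_on Omega (f e) -> smooth_on Omega (g e) ->
  smooth_on Omega ((f - g) e).
Proof.
move=> sf sg; have -> : (f - g) e = f e + (- 1) *: g e by rewrite scaleN1r.
exact (smoothD (opensP Omega) sf (smoothZ (- 1) (opensP Omega) sg)).
Qed.

Lemma littleo_sub Omega f g (h : R -> R) l K :
  compact K -> K `<=` Omega ->
  (forall e, 0 < e <= 1 -> smooth_on Omega (f e)) ->
  (forall e, 0 < e <= 1 -> smooth_on Omega (g e)) ->
  (fun e => seminorm K l (f e)) =o_ (0^'+) h ->
  (fun e => seminorm K l (g e)) =o_ (0^'+) h ->
  (fun e => seminorm K l ((f - g) e)) =o_ (0^'+) h.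
Proof.
move=> cK KO sf sg /eqoP fh /eqoP gh; apply/eqoP => eps eps0.
have eps20 : 0 < eps / 2 by rewrite divr_gt0.
near=> e.
have e01 : 0 < e <= 1 by near: e; exact: near01.
have f0 := seminorm_ge0 l cK KO (sf _ e01).
have g0 := seminorm_ge0 l cK KO (sg _ e01).
have fg0 : 0 <= seminorm K l ((f - g) e).
  exact: (seminorm_ge0 l cK KO (smooth_netB (sf _ e01) (sg _ e01))).
rewrite ger0_norm// (le_trans (seminormB l (opensP Omega) cK KO (sf _ e01) (sg _ e01)))//.
rewrite [leRHS](_ : _ = eps / 2 * `|h e| + eps / 2 * `|h e|); last by rewrite -mulrDl -splitr.
apply: lerD.
  by rewrite -[leLHS]ger0_norm//; near: e; exact: fh.
by rewrite -[leLHS]ger0_norm//; near: e; exact: gh.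
Unshelve. all: by end_near. Qed.

Definition moderate_pred Omega : {pred R -> E -> R[i]} :=
  fun f => `[< moderate Omega f >].

Lemma littleo_pow (f : R -> R) (m n : nat) : (m <= n)%N ->
  f =o_ (0^'+) (fun e => e ^- m) -> f =o_ (0^'+) (fun e => e ^- n).
Proof.
move=> mn /eqoP fm; apply/eqoP => eps eps0; near=> e.
have /andP[e0 e1] : 0 < e <= 1 by near: e; exact: near01.
apply: (@le_trans _ _ (eps * `|e ^- m|)); first by near: e; exact: fm.
rewrite !ger0_norm ?invr_ge0 ?exprn_ge0 ?(ltW e0)// ler_pM2l//.
rewrite lef_pV2 ?posrE ?exprn_gt0//.
by apply: ler_wiXn2l => //; exact: ltW.
Unshelve. all: by end_near. Qed.

Lemma littleo0 K l (h : R -> R) :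
  (fun e => seminorm K l ((0 : R -> E -> R[i]) e)) =o_ (0^'+) h.
Proof.
apply/eqoP => eps eps0; near=> e.
by rewrite (seminorm0 K l) normr0 mulr_ge0 ?(ltW eps0).
Unshelve. all: by end_near. Qed.

Lemma moderate_zmod_closed Omega : zmod_closed (moderate_pred Omega).
Proof.
split=> [|f g /asboolP[sf mf] /asboolP[sg mg]].
  apply/asboolP; split=> [e _|l K _ _]; first exact: (@smooth_cst R d Omega 0).
  by exists 0%N; exact: littleo0.
apply/asboolP; split=> [e e01|l K cK KO].
  by apply: smooth_netB; [exact: sf|exact: sg].
have [q fq] := mf l K cK KO; have [r gr] := mg l K cK KO.
exists (maxn q r); apply: littleo_sub sf sg _ _ => //.
  exact: littleo_pow (leq_maxl _ _) fq.
exact: littleo_pow (leq_maxr _ _) gr.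
Qed.

HB.instance Definition _ Omega := GRing.isZmodClosed.Build (R -> E -> R[i])
  (moderate_pred Omega) (moderate_zmod_closed Omega).

End Colombeau.

Record moderate_net {R : realType} {d : nat} (Omega : opens R d) := ModerateNet {
  moderate_net_fun :> R -> 'rV[R]_d -> R[i];
  _ : moderate_net_fun \in moderate_pred Omega }.

Section ColombeauAlgebra.
Context {R : realType} {d : nat}.
Local Notation E := 'rV[R]_d.
Context (Omega : opens R d).

HB.instance Definition _ := [isSub for @moderate_net_fun R d Omega].
HB.instance Definition _ := [Choice of moderate_net Omega by <:].
HB.instance Definition _ := [SubChoice_isSubZmodule of moderate_net Omega by <:].

Definition negligible_pred : {pred moderate_net Omega} :=
  fun f => `[< negligible_net Omega f >].

Lemma moderate_netP (f : moderate_net Omega) : moderate Omega f.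
Proof. by case: f => f /= /asboolP. Qed.

Lemma negligible_zmod_closed : zmod_closed negligible_pred.
Proof.
split=> [|f g /asboolP nf /asboolP ng]; apply/asboolP => l K cK KO p.
  exact: littleo0.
exact: littleo_sub cK KO (moderate_netP f).1 (moderate_netP g).1
  (nf l K cK KO p) (ng l K cK KO p).
Qed.

HB.instance Definition _ := GRing.isZmodClosed.Build (moderate_net Omega)
  negligible_pred negligible_zmod_closed.

(* The quotient of additive groups; its multiplication is not needed here. *)
Definition colombeau := {ideal_quot negligible_pred}.

(* The class modulo negligible nets of a moderate net; 0 if [f] is not moderate. *)
Definition net_class (f : R -> E -> R[i]) : colombeau :=
  (\pi_colombeau (insubd (0 : moderate_net Omega) f))%qT.

End ColombeauAlgebra.
Arguments net_class {R d} Omega f.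

Section Restriction.
Context {R : realType} {d : nat}.
Local Notation E := 'rV[R]_d.
Context (Omega Omega' : opens R d) (sub : Omega' `<=` Omega).

Lemma restrict_net_subproof (f : moderate_net Omega) :
  (f : R -> E -> R[i]) \in moderate_pred Omega'.
Proof.
have [sf mf] := moderate_netP f; apply/asboolP; split.
  by move=> e /sf se w x /sub; exact: se.
by move=> l K cK KO; apply: mf => //; exact: subset_trans sub.
Qed.

Definition restrict_net f : moderate_net Omega' :=
  ModerateNet (restrict_net_subproof f).

Definition restrict (u : colombeau Omega) : colombeau Omega' :=
  (\pi_(colombeau Omega') (restrict_net (repr u)))%qT.

Lemma restrict_pi (f : moderate_net Omega) :
  restrict (\pi_(colombeau Omega) f)%qT =
  (\pi_(colombeau Omega') (restrict_net f))%qT.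
Proof.
apply/eqP; rewrite -Quotient.idealrBE; apply/asboolP.
have : (repr (\pi_(colombeau Omega) f)%qT) - f \in @negligible_pred R d Omega.
  by rewrite Quotient.idealrBE reprK.
move=> /asboolP nf l K cK KO; apply: nf => //; exact: subset_trans sub.
Qed.

End Restriction.

Section Embeddings.
Context {R : realType} {d : nat}.
Local Notation E := 'rV[R]_d.
Implicit Types (T : distribution R d) (rho : smoothfun R d) (chi : testfun R d).

Definition mollifier_fun rho (e : R) : E -> R[i] :=
  fun x => (e ^- d)%:C * rho (e^-1 *: x).

Lemma mollifier_subproof rho e : mollifier_fun rho e \in smooth_pred.
Proof.
have -> : mollifier_fun rho e = (e ^- d)%:C *: affine 0 e^-1 rho.
  by apply/funext => x; rewrite /mollifier_fun !fctE /affine add0r.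
exact/asboolP/(smoothZ _ openT)/smooth_affine/smoothfunP.
Qed.

Definition mollifier rho e : smoothfun R d := SmoothFun (mollifier_subproof rho e).

Definition theta_fun rho chi (e : R) : E -> R[i] :=
  fun x => mollifier rho e x * chi (`|ln e| *: x).

Lemma theta_subproof rho chi e : 0 < e < 1 -> theta_fun rho chi e \in test_pred.
Proof.
move=> /andP[e0 e1].
have ln0 : `|ln e| != 0 by rewrite normr_eq0 lt_eqF// ln_lt0// e0.
have -> : theta_fun rho chi e = affine 0 `|ln e| chi * (mollifier rho e : E -> R[i]).
  by apply/funext => x; rewrite !fctE /affine add0r mulrC.
have sa := smooth_affine 0 `|ln e| (testfunP chi).
have ca := @compact_supp_affine R d 0 _ _ ln0 (@testfun_compact _ _ chi).
exact: (testM_subproof (TestFun (asboolT (conj sa ca))) (mollifier rho e)).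
Qed.

Definition theta rho chi e (e01 : 0 < e < 1) : testfun R d :=
  TestFun (theta_subproof rho chi e01).

(* The indices outside (0, 1], given the value 0 here like the index 1, are
   irrelevant. *)
Definition iotaS rho chi T : colombeau (fullspace R d) :=
  net_class (fullspace R d) (fun e =>
    if @idP (0 < e < 1) is ReflectT e01 then conv T (theta rho chi e01) else 0).

Definition iota0 rho (S : cdistribution R d) : colombeau (fullspace R d) :=
  net_class (fullspace R d) (fun e => cconv S (mollifier rho e)).

Definition iota_loc rho (Omega : opens R d) (psi : testfun R d) T :
    colombeau Omega :=
  restrict (@sub_fullspace R d Omega) (iota0 rho (mulD psi T)).

(* Definite description: such a map exists by coherence of the [iota_loc] and is
   unique because [colombeau] is a sheaf; the default value is not used. *)
Definition iotaA rho (L : Type) (Omega : L -> opens R d) (psi : L -> testfun R d) :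
    distribution R d -> colombeau (fullspace R d) :=
  xget (fun=> 0) [set iota | forall l T,
    restrict (@sub_fullspace R d (Omega l)) (iota T) = iota_loc rho (Omega l) (psi l) T].

End Embeddings.

(* The library's sigma-finiteness instance for [\x] is shadowed by the one for
   products of probability measures, hence this copy. *)
Section LebesgueProduct.
Context {R : realType} {disp : measure_display} {T : measurableType disp}.
Context (mu : {sigma_finite_measure set T -> \bar R}).

Definition lebesgue_prod : set (measurableTypeR R * T)%type -> \bar R :=
  (@lebesgue_measure R \x mu)%E.

Lemma lebesgue_prod_sigma_finite : sigma_finite setT lebesgue_prod.
Proof.
have /sigma_finiteP[F [TF ndF Foo]] := sigma_finiteT (@lebesgue_measure R).
have /sigma_finiteP[G [TG ndG Goo]] := sigma_finiteT mu.
exists (fun n => F n `*` G n).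
  rewrite -setXTT TF TG predeqE => -[x y]; split.
    move=> [/= [n _ Fnx] [k _ Gky]]; exists (maxn n k) => //; split.
    - by move: x Fnx; exact/subsetPset/ndF/leq_maxl.
    - by move: y Gky; exact/subsetPset/ndG/leq_maxr.
  by move=> [n _ []/= ? ?]; split; exists n.
move=> k; have [? ?] := Foo k; have [? ?] := Goo k.
split; first exact: measurableX.
by rewrite /lebesgue_prod product_measure1E// lte_mul_pinfty// ge0_fin_numE.
Qed.

HB.instance Definition _ := Measure.on lebesgue_prod.
HB.instance Definition _ := Measure_isSigmaFinite.Build _ _ _ lebesgue_prod
  lebesgue_prod_sigma_finite.

End LebesgueProduct.

Section LebesgueIntegral.
Context (R : realType).

(* A measured space with coordinates in R^n; [lebesgue_space n] is the n-fold
   product of the Lebesgue measure on R. *)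
Record coord_space (n : nat) := CoordSpace {
  cs_display : measure_display;
  cs_type : measurableType cs_display;
  cs_measure : {sigma_finite_measure set cs_type -> \bar R};
  cs_coord : cs_type -> 'rV[R]_n }.

Fixpoint lebesgue_space n : coord_space n :=
  if n is m.+1 return coord_space n then
    @CoordSpace m.+1 _ (measurableTypeR R * cs_type (lebesgue_space m))%type
      (lebesgue_prod (cs_measure (lebesgue_space m)))
      (fun p => row_mx (const_mx p.1 : 'rV_1) (cs_coord p.2))
  else @CoordSpace 0 _ unit (dirac tt) (fun=> 0).

Definition integral_rV n (f : 'rV[R]_n -> R) : R :=
  \int[cs_measure (lebesgue_space n)]_t f (cs_coord t).

Definition cintegral n (f : 'rV[R]_n -> R[i]) : R[i] :=
  integral_rV (@complex.Re R \o f) +i* integral_rV (@complex.Im R \o f).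

End LebesgueIntegral.

Section Ambient.
Context {R : realType} {d : nat}.
Local Notation E := 'rV[R]_d.

(* The norm of ['rV[R]_d] in the library is the sup norm. *)
Definition enorm (x : E) : R := Num.sqrt (\sum_i x 0 i ^+ 2).

Definition monomial (m : {ffun 'I_d -> nat}) (x : E) : R := \prod_i x 0 i ^+ m i.

Definition rapidly_decreasing (f : E -> R[i]) :=
  forall a b : {ffun 'I_d -> nat}, exists c : R, forall x,
    normc ((monomial b x)%:C * mderive a f x) <= c.

Definition open_cover (L : Type) (Omega : L -> opens R d) :=
  \bigcup_l (Omega l : set E) = setT.

Definition locally_finite (L : Type) (Omega : L -> opens R d) :=
  forall x : E, exists2 U, nbhs x U &
    finite_set [set l | (Omega l : set E) `&` U !=set0].

End Ambient.

Record schwartz (R : realType) (d : nat) := Schwartz {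
  schwartz_fun :> smoothfun R d;
  _ : rapidly_decreasing schwartz_fun }.

(* Main.v *)
Require Import Defs.
From mathcomp Require Import all_boot all_order all_algebra.
From mathcomp Require Import all_classical all_reals all_analysis.
From mathcomp Require Import complex ring_quotient ring lra zify.
Set Implicit Arguments. Unset Strict Implicit. Unset Printing Implicit Defensive.
Import Order.TTheory GRing.Theory Num.Theory.
Import numFieldNormedType.Exports.
Import Normc.
Local Open Scope classical_set_scope.
Local Open Scope ring_scope.
Local Open Scope complex_scope.

(** The map [iotaA] is described by its restrictions to the members of the cover,
    and a class of nets on the whole space is determined by such restrictions
    ([colombeau_separated]). It is therefore enough that [iotaS] has the defining
    property of [iotaA]: on each [Omega l], the nets [T * theta_e] and
    [(psi_l T) * rho_e] differ by a negligible net.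

    The support of [theta_e] lies in a ball of radius proportional to
    [1 / |ln e|], so that for small [e] the convolution [T * theta_e] only sees,
    from the points of [Omega l], the part of [T] where [psi_l] is 1: on [Omega l]
    it equals [(psi_l T) * theta_e] ([iotaS_net_local]). What remains is
    [(psi_l T) * (rho_e - theta_e)]. Since [psi_l T] has compact support, its
    convolution with a smooth function is bounded, together with its derivatives,
    by finitely many derivatives of that function ([seminorm_cconv]). Finally
    [rho_e - theta_e] vanishes on a ball of radius [c / |ln e|], and outside of
    it the rapid decay of [rho] makes all derivatives smaller than any power of
    [e] ([mollifier_tail]).

    A class is attached to a net only when the net is moderate, so the same
    estimates also have to give smoothness and moderateness of both nets
    ([moderate_iotaS], [moderate_mollifier]). Differentiating a convolution takes
    the convergence of the difference quotients of a smooth function with all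
    their derivatives ([difference_quotient_cvg], [derivable_cconv]), which rests
    on the symmetry of second derivatives ([derive_swap]). *)

(** * Symmetry of second derivatives *)

Section Lines.
Context {R : realType} {d : nat}.
Local Notation E := 'rV[R]_d.
Implicit Types (g : E -> R) (x u v : E).

Lemma is_derive_line g x v (s : R) : derivable g (x + s *: v) v ->
  is_derive s 1 (fun t : R => g (x + t *: v)) ('D_v g (x + s *: v)).
Proof.
move=> dg.
have e : (fun h : R => h^-1 *: (((fun t : R => g (x + t *: v)) \o shift s) (h *: 1)
            - g (x + s *: v))) =
         (fun h => h^-1 *: ((g \o shift (x + s *: v)) (h *: v) - g (x + s *: v))).
  apply/funext => h /=; congr (_ *: (g _ - _)).
  by rewrite -[h *: 1]/(h * 1) mulr1 scalerDl addrCA.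
split; first by rewrite /derivable e.
by rewrite /derive e.
Qed.

Lemma mvt_line g x v (t : R) : (forall y, derivable g y v) ->
  exists2 s, `|s| <= `|t| & g (x + t *: v) - g x = t * 'D_v g (x + s *: v).
Proof.
move=> dg; pose k (s : R) := g (x + s *: v).
have dk (s : R) : is_derive s 1 k ('D_v g (x + s *: v)) by exact: is_derive_line.
have kc : continuous k.
  move=> s; apply: differentiable_continuous; apply/derivable1_diffP.
  by have [] := dk s.
have k0 : k 0 = g x by rewrite /k scale0r addr0.
have [t0|/ltW t0] := leP 0 t.
  have [s] := MVT_segment t0 (fun s _ => dk s) (continuous_subspaceT kc).
  rewrite in_itv/= => /andP[s0 st]; rewrite k0 subr0 => e.
  by exists s; [rewrite !ger0_norm// (le_trans s0)|rewrite mulrC].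
have [s] := MVT_segment t0 (fun s _ => dk s) (continuous_subspaceT kc).
rewrite in_itv/= => /andP[s0 st]; rewrite k0 sub0r => e.
exists s; first by rewrite !ler0_norm// lerN2.
by rewrite -/(k t) -opprB e mulrN opprK mulrC.
Qed.

(** By two applications of the mean value theorem, the second difference of [g]
    along the parallelogram spanned by [h *: u] and [h *: v] is [h * h] times the
    value of one mixed derivative at a point near [x]. Taking the directions in
    the other order gives the same for the other mixed derivative, and continuity
    concludes as [h] tends to 0. *)
Lemma derive_swap g x u v :
  (forall y, derivable g y u) -> (forall y, derivable g y v) ->
  (forall y, derivable ('D_u g) y v) -> (forall y, derivable ('D_v g) y u) ->
  {for x, continuous ('D_v ('D_u g))} -> {for x, continuous ('D_u ('D_v g))} ->
  'D_v ('D_u g) x = 'D_u ('D_v g) x.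
Proof.
have swap4 (p q r s : R) : p - q - (r - s) = p - r - (q - s) by lra.
have diff2 u' v' : (forall y, derivable g y u') ->
    (forall y, derivable ('D_u' g) y v') -> forall h, exists a b,
    [/\ `|a| <= `|h|, `|b| <= `|h| &
      g (x + h *: v' + h *: u') - g (x + h *: u') - (g (x + h *: v') - g x) =
      h * (h * 'D_v' ('D_u' g) (x + a *: u' + b *: v'))].
  move=> du duv h.
  pose k y := g (y + h *: v') - g y.
  have dS y : is_derive y u' (fun z => g (z + h *: v')) ('D_u' g (y + h *: v')).
    have e : (fun t : R => t^-1 *: (((fun z => g (z + h *: v')) \o shift y) (t *: u')
               - g (y + h *: v'))) =
             (fun t => t^-1 *: ((g \o shift (y + h *: v')) (t *: u') - g (y + h *: v'))).
      by apply/funext => t /=; rewrite addrA.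
    by split; [rewrite /derivable e; exact: du|rewrite /derive e].
  have dk y : is_derive y u' k ('D_u' g (y + h *: v') - 'D_u' g y).
    by apply: is_deriveB; exact: derivableP.
  have [a ah ea] := mvt_line x h (fun y => @ex_derive _ _ _ _ _ _ _ (dk y)).
  have [b bh eb] := mvt_line (x + a *: u') h duv.
  exists a, b; split=> //.
  rewrite -eb -(@derive_val _ _ _ _ _ _ _ (dk _)) -ea /k.
  by rewrite [x + h *: v' + h *: u']addrAC.
move=> du dv duv dvu cuv cvu; apply/eqP; rewrite -subr_eq0 -normr_le0.
apply/ler_addgt0Pr => eps eps0; rewrite add0r.
have e2 : 0 < eps / 2 by rewrite divr_gt0.
have near2 (f : E -> R) : {for x, continuous f} ->
    \forall h \near (0 : R)^'+, forall a b : R, `|a| <= `|h| -> `|b| <= `|h| ->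
      `|f x - f (x + a *: u + b *: v)| <= eps / 2.
  move=> /cvgrPdist_le/(_ _ e2)/nbhs_ballP[r /= r0 rf].
  have M0 : 0 < `|u| + `|v| + 1 by rewrite ltr_wpDl// addr_ge0.
  near=> h => a b ah bh; apply: rf; rewrite -ball_normE/=.
  rewrite -addrA opprD addNKr normrN.
  apply: (@le_lt_trans _ _ (`|h| * (`|u| + `|v|))).
    rewrite (le_trans (ler_normD _ _))// mulrDr !normrZ.
    by apply: lerD; apply: ler_wpM2r.
  apply: (@le_lt_trans _ _ (`|h| * (`|u| + `|v| + 1))).
    by rewrite ler_wpM2l// lerDl.
  rewrite -ltr_pdivlMr// gtr0_norm; last by near: h; exact: nbhs_right_gt.
  by near: h; apply: nbhs_right_lt; rewrite divr_gt0.
have nuv := near2 _ cuv; have nvu := near2 _ cvu.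
have hF : ProperFilter ((0 : R)^'+) by exact: at_right_proper_filter.
have [h [[h0 Hu] Hv]] := filter_ex (filterI (filterI (nbhs_right_gt (0 : R)) nuv) nvu).
have [a [b [ah bh eab]]] := diff2 _ _ du duv h.
have [b' [a' [b'h a'h eab']]] := diff2 _ _ dv dvu h.
have {eab eab'} E : 'D_v ('D_u g) (x + a *: u + b *: v) =
    'D_u ('D_v g) (x + a' *: u + b' *: v).
  rewrite [x + a' *: u + b' *: v]addrAC.
  apply: (mulfI (lt0r_neq0 h0)); apply: (mulfI (lt0r_neq0 h0)).
  apply: etrans (esym eab) (etrans _ eab').
  by rewrite (addrAC x (h *: u)); exact: swap4.
apply: le_trans (ler_distD ('D_v ('D_u g) (x + a *: u + b *: v)) _ _) _.
rewrite [leRHS]splitr; apply: lerD; first exact: Hu.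
by rewrite E distrC; exact: Hv.
Unshelve. all: by end_near. Qed.

End Lines.

(** * Iterated derivatives and continuity *)

Section Words.
Context {R : realType} {d : nat}.
Local Notation E := 'rV[R]_d.
Implicit Types (f g : E -> R[i]) (x y z v : E) (i j : 'I_d) (w u : seq 'I_d).

Lemma partial_swap f i j : smooth_on setT f ->
  partial i (partial j f) = partial j (partial i f).
Proof.
move=> sf; apply/funext => x.
have D k y := smooth_cderivable k sf (I : setT y).
have DD k l y : cderivable (partial l f) y (delta_mx 0 k).
  exact: smooth_cderivable (smooth_partial l sf) _.
have C k l : ccontinuous_at (partial k (partial l f)) x := (sf [:: k; l] x I).1.
have er : 'D_(delta_mx 0 i) ('D_(delta_mx 0 j) (@complex.Re R \o f)) x =
          'D_(delta_mx 0 j) ('D_(delta_mx 0 i) (@complex.Re R \o f)) x.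
  by apply: derive_swap => [y|y|y|y||];
    [exact: (D j y).1|exact: (D i y).1|exact: (DD i j y).1|
     exact: (DD j i y).1|exact: (C i j).1|exact: (C j i).1].
have ei : 'D_(delta_mx 0 i) ('D_(delta_mx 0 j) (@complex.Im R \o f)) x =
          'D_(delta_mx 0 j) ('D_(delta_mx 0 i) (@complex.Im R \o f)) x.
  by apply: derive_swap => [y|y|y|y||];
    [exact: (D j y).2|exact: (D i y).2|exact: (DD i j y).2|
     exact: (DD j i y).2|exact: (C i j).2|exact: (C j i).2].
exact: (congr2 (fun a b => a +i* b) er ei).
Qed.

Lemma partials_partial f i w : smooth_on setT f ->
  partials w (partial i f) = partial i (partials w f).
Proof.
move=> sf; elim: w => [//|j w /= ->].
exact/partial_swap/smooth_partials.
Qed.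

Lemma partials_cat w u f : partials (w ++ u) f = partials w (partials u f).
Proof. by rewrite /partials foldr_cat. Qed.

(** Multi-indices take the variables in a fixed order, and the decay of a Schwartz
    function is stated with multi-indices; the derivatives of a convolution run
    over words in an arbitrary order. *)
Lemma perm_partials f w u : smooth_on setT f -> perm_eq w u ->
  partials w f = partials u f.
Proof.
move=> sf; elim: w u => [|i w IH] u; first by rewrite perm_sym => /perm_nilP ->.
move=> iwu; have iu : i \in u by rewrite -(perm_mem iwu) mem_head.
case/splitPr: iu iwu => u1 u2 iwu.
have wu : perm_eq w (u1 ++ u2).
  by move: iwu; rewrite -[i :: w]/([:: i] ++ w) -[i :: u2]/([:: i] ++ u2)
    perm_sym perm_catCA perm_cat2l perm_sym.
rewrite /= (IH _ wu) !partials_cat /=.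
by rewrite partials_partial//; exact: smooth_partials.
Qed.

Lemma partials_mderive f w : smooth_on setT f ->
  partials w f = mderive [ffun i => count_mem i w] f.
Proof.
move=> sf; apply: perm_partials => //; apply/allP => i _ /=.
by rewrite count_mword ffunE.
Qed.

(** Words of bounded length are finite in number, which is what makes the
    estimates below uniform over all derivatives of bounded order. *)
Lemma near_words (T : Type) (F : set_system T) {FF : Filter F}
    (P : seq 'I_d -> T -> Prop) l :
  (forall w, \forall t \near F, P w t) ->
  \forall t \near F, forall w, (size w <= l)%N -> P w t.
Proof.
move=> FP.
have : \forall t \near F, forall k : 'I_l.+1, forall w : k.-tuple 'I_d, P w t.
  by apply: filter_forall => k; apply: filter_forall => w; exact: FP.
by apply: filterS => t Pt w wl; exact: (Pt (Ordinal (wl : (size w < l.+1)%N)) (in_tuple w)).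
Qed.

Lemma words_bound (P : seq 'I_d -> R -> Prop) l :
  (forall w M N, M <= N -> P w M -> P w N) -> (forall w, exists M, P w M) ->
  exists2 M, 0 <= M & forall w, (size w <= l)%N -> P w M.
Proof.
move=> Pmono PM.
have : \forall M \near +oo, forall w, (size w <= l)%N -> P w M.
  apply: near_words => w; have [M PwM] := PM w.
  by near=> N; apply: Pmono PwM; near: N; apply: nbhs_pinfty_ge; exact: num_real.
move=> hM; have [M [HM M0]] := filter_ex (filterI hM (nbhs_pinfty_ge (num_real (0 : R)))).
by exists M.
Unshelve. all: by end_near. Qed.

Lemma normcZ_real (a : R) (z : R[i]) : normc (a%:C * z) = `|a| * normc z.
Proof. by rewrite normcM /= expr0n/= addr0 sqrtr_sqr. Qed.

Lemma Re_le_normc (z : R[i]) : `|complex.Re z| <= normc z.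
Proof.
by case: z => a b /=; rewrite -sqrtr_sqr ler_wsqrtr// lerDl sqr_ge0.
Qed.

Lemma Im_le_normc (z : R[i]) : `|complex.Im z| <= normc z.
Proof.
by case: z => a b /=; rewrite -sqrtr_sqr ler_wsqrtr// lerDr sqr_ge0.
Qed.

Lemma ccontinuous_normc f x :
  (forall eps, 0 < eps -> \forall v \near (0 : E), normc (f (x + v) - f x) <= eps) ->
  ccontinuous_at f x.
Proof.
move=> H.
have aux (p : R[i] -> R) : (forall z t : R[i], `|p z - p t| <= normc (z - t)) ->
    {for x, continuous (p \o f)}.
  move=> ple; apply/(@cvgrPdist_le _ _ _ (nbhs x)) => eps eps0.
  suff : \forall y \near x, `|p (f x) - p (f y)| <= eps by [].
  rewrite nbhs0P.
  by apply: filterS (H _ eps0) => v; apply: le_trans; rewrite distrC.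
split; apply: aux => z t.
  by case: z t => [? ?] [? ?]; exact: Re_le_normc (_ +i* _).
by case: z t => [? ?] [? ?]; exact: Im_le_normc (_ +i* _).
Qed.

Lemma cderivable_normc f x i (l : R[i]) :
  (forall eps, 0 < eps -> \forall h \near (0 : R)^',
     normc ((h^-1)%:C * (f (h *: delta_mx 0 i + x) - f x) - l) <= eps) ->
  cderivable f x (delta_mx 0 i) /\ partial i f x = l.
Proof.
move=> H.
have aux (p : R[i] -> R) : (forall z : R[i], `|p z| <= normc z) ->
    (forall z t : R[i], p (z - t) = p z - p t) -> (forall (a : R) (z : R[i]), p (a%:C * z) = a * p z) ->
    derivable (p \o f) x (delta_mx 0 i) /\ 'D_(delta_mx 0 i) (p \o f) x = p l.
  move=> p1 pB pM.
  have cv : (fun h : R => h^-1 *: (((p \o f) \o shift x) (h *: delta_mx 0 i) - (p \o f) x))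
      @ (0 : R)^' --> p l.
    apply/cvgrPdist_le => eps eps0; have := H _ eps0.
    apply: filterS => h /=; apply: le_trans; rewrite distrC.
    by rewrite -[_ *: _]/(_ * _) -pB -pM -pB.
  by split; [apply/cvg_ex; exists (p l)|exact: cvg_lim].
have [dr er] : derivable (@complex.Re R \o f) x (delta_mx 0 i) /\
    'D_(delta_mx 0 i) (@complex.Re R \o f) x = complex.Re l.
  apply: aux; first exact: Re_le_normc.
    by case=> [? ?] [? ?].
  by move=> a [? ?] /=; rewrite mul0r subr0.
have [di ei] : derivable (@complex.Im R \o f) x (delta_mx 0 i) /\
    'D_(delta_mx 0 i) (@complex.Im R \o f) x = complex.Im l.
  apply: aux; first exact: Im_le_normc.
    by case=> [? ?] [? ?].
  by move=> a [? ?] /=; rewrite mul0r addr0.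
by split; [split|rewrite /partial er ei; case: (l)].
Qed.

Lemma uniform_continuity f K : compact K -> (forall x, ccontinuous_at f x) ->
  forall eps, 0 < eps -> \forall v \near (0 : E), forall z, K z ->
    normc (f (z + v) - f z) <= eps.
Proof.
move=> /compact_near_coveringP cK cf eps eps0.
have e4 : 0 < eps / 2 / 2 by rewrite !divr_gt0.
refine (cK E (nbhs (0 : E)) (fun v z => normc (f (z + v) - f z) <= eps) _ _) => x Kx.
have [cr ci] := cf x.
have near_p (p : R[i] -> R) : {for x, continuous (p \o f)} ->
    \forall z \near x & v \near (0 : E), `|p (f (z + v)) - p (f z)| <= eps / 2.
  move=> /cvgrPdist_le/(_ _ e4)/nbhs_ballP[r /= r0 rf].
  have r20 : 0 < r / 2 by rewrite divr_gt0.
  exists (ball x (r / 2), ball (0 : E) (r / 2)).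
    by split; exact: nbhsx_ballx.
  move=> [z v] [/= xz v0]; have v0' : `|v| < r / 2.
    by move: v0; rewrite -ball_normE/= sub0r normrN.
  move: xz; rewrite -ball_normE/= => xz.
  apply: le_trans (ler_distD (p (f x)) _ _) _; rewrite [leRHS]splitr; apply: lerD.
    rewrite distrC; apply: rf; rewrite -ball_normE/= opprD addrA.
    by rewrite (le_lt_trans (ler_normB _ _))// [ltRHS]splitr ltrD.
  by apply: rf; rewrite -ball_normE/= (lt_le_trans xz)// [leRHS]splitr lerDl ltW.
apply: filterS2 (near_p _ cr) (near_p _ ci) => -[z v] /= nr ni.
apply: le_trans (normc_le _) _; rewrite [leRHS]splitr; apply: lerD.
  by rewrite ReD; have -> : complex.Re (- f z) = - complex.Re (f z) by case: (f z).
by rewrite ImD; have -> : complex.Im (- f z) = - complex.Im (f z) by case: (f z).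
Qed.

End Words.

(** * Convolution with a compactly supported distribution *)

Section Convolution.
Context {R : realType} {d : nat}.
Local Notation E := 'rV[R]_d.
Implicit Types (f g : E -> R[i]) (x y z v : E) (i j : 'I_d) (w u : seq 'I_d)
  (phi : smoothfun R d) (S : cdistribution R d) (K : set E).

(** The mean value theorem turns the difference quotient at [z] into a value of
    the derivative at a point within [`|h|] of [z], so that the uniform continuity
    of the derivative on [K] suffices. Real and imaginary parts have different
    intermediate points and get half of [eps] each. *)
Lemma difference_quotient_cvg f i K : smooth_on setT f -> compact K ->
  forall eps, 0 < eps -> \forall h \near (0 : R)^', forall z, K z ->
    normc ((h^-1)%:C * (f (z + h *: delta_mx 0 i) - f z) - partial i f z) <= eps.
Proof.
move=> sf cK eps eps0; have e2 : 0 < eps / 2 by rewrite divr_gt0.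
have cp x : ccontinuous_at (partial i f) x := (sf [:: i] x I).1.
have := near0Z (delta_mx 0 i) (uniform_continuity cK cp e2).
move=> /nbhs_ballP[r /= r0 rP].
have df y := smooth_cderivable i sf (I : setT y).
near=> h => z Kz.
have h0 : h != 0 by near: h; exact: nbhs_dnbhs_neq.
have hr : `|h| < r.
  have : ball (0 : R) r h by near: h; apply: nbhs_dnbhs; exact: nbhsx_ballx.
  by rewrite -ball_normE/= sub0r normrN.
have quotient (p : R[i] -> R) : (forall z t : R[i], p (z - t) = p z - p t) ->
    (forall z : R[i], `|p z| <= normc z) ->
    (forall y, derivable (p \o f) y (delta_mx 0 i)) ->
    (forall y, 'D_(delta_mx 0 i) (p \o f) y = p (partial i f y)) ->
    `|h^-1 * (p (f (z + h *: delta_mx 0 i)) - p (f z)) - p (partial i f z)| <= eps / 2.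
  move=> pB p1 dp ep; have [s sh /= ->] := mvt_line z h dp.
  rewrite mulKf// ep -pB (le_trans (p1 _))//; apply: (rP s) => //.
  by rewrite -ball_normE/= sub0r normrN (le_lt_trans sh).
apply: le_trans (normc_le _) _; rewrite [leRHS]splitr; apply: lerD.
  have -> : complex.Re ((h^-1)%:C * (f (z + h *: delta_mx 0 i) - f z) - partial i f z) =
      h^-1 * (complex.Re (f (z + h *: delta_mx 0 i)) - complex.Re (f z)) -
      complex.Re (partial i f z).
    by case: (f _) (f z) (partial i f z) => [? ?] [? ?] [? ?] /=; ring.
  apply: (quotient (@complex.Re R)) => //; first by case=> [? ?] [? ?].
    exact: Re_le_normc.
  by move=> y; exact: (df y).1.
have -> : complex.Im ((h^-1)%:C * (f (z + h *: delta_mx 0 i) - f z) - partial i f z) =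
    h^-1 * (complex.Im (f (z + h *: delta_mx 0 i)) - complex.Im (f z)) -
    complex.Im (partial i f z).
  by case: (f _) (f z) (partial i f z) => [? ?] [? ?] [? ?] /=; ring.
apply: (quotient (@complex.Im R)) => //; first by case=> [? ?] [? ?].
  exact: Im_le_normc.
by move=> y; exact: (df y).2.
Unshelve. all: by end_near. Qed.

Lemma partialsZT (c : R[i]) f w : smooth_on setT f ->
  partials w (c *: f) = c *: partials w f.
Proof.
by move=> sf; apply/funext => x; apply: (partialsZ w c openT sf); rewrite inE.
Qed.

Lemma partialsBT f g w : smooth_on setT f -> smooth_on setT g ->
  partials w (f - g) = partials w f - partials w g.
Proof.
by move=> sf sg; apply/funext => x; apply: (partialsB w openT sf sg); rewrite inE.
Qed.

Lemma smoothB f g : smooth_on setT f -> smooth_on setT g ->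
  smooth_on setT (f - g).
Proof.
by move=> sf sg; rewrite -scaleN1r; exact: (smoothD openT sf (smoothZ _ openT sg)).
Qed.

Lemma partial_affine x (c : R) f i : smooth_on setT f ->
  partial i (affine x c f) = c%:C *: affine x c (partial i f).
Proof.
move=> sf; apply/funext => y.
have [dr di] := smooth_cderivable i sf (I : setT (x + c *: y)).
rewrite /partial (derive_affine dr).2 (derive_affine di).2.
by rewrite !fctE /affine; apply/eqP; rewrite eq_complex/= !mul0r subr0 addr0 !eqxx.
Qed.

Lemma partials_affine x (c : R) f w : smooth_on setT f ->
  partials w (affine x c f) = (c ^+ size w)%:C *: affine x c (partials w f).
Proof.
move=> sf; elim: w => [|i w IH]; first by rewrite scale1r.
have sw := smooth_partials w sf.
rewrite -[LHS]/(partials [:: i] (partials w (affine x c f))) IH.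
rewrite partialsZT; last exact: smooth_affine.
rewrite -[partials [:: i] _]/(partial i _) partial_affine//.
by rewrite scalerA -rmorphM /= exprSr.
Qed.

Lemma partials_refl x phi w y :
  partials w (smooth_refl x phi) y = ((-1) ^+ size w)%:C * partials w phi (x - y).
Proof.
rewrite /= reflE partials_affine; last exact: smoothfunP.
by rewrite !fctE /affine scaleN1r.
Qed.

Lemma translate_subproof v phi : affine v 1 phi \in smooth_pred.
Proof. by apply/asboolP/smooth_affine/smoothfunP. Qed.
Definition translate v phi : smoothfun R d := SmoothFun (translate_subproof v phi).

Lemma partials_translate v phi w y :
  partials w (translate v phi) y = partials w phi (y + v).
Proof.
rewrite /= partials_affine; last exact: smoothfunP.
by rewrite expr1n rmorph1 scale1r /affine scale1r addrC.
Qed.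

Lemma derivative_subproof w phi : partials w phi \in smooth_pred.
Proof. by apply/asboolP/smooth_partials/smoothfunP. Qed.
Definition derivative w phi : smoothfun R d := SmoothFun (derivative_subproof w phi).

Lemma cconvP S x (a : R[i]) phi psi :
  cconv S (a *: phi + psi) x = a * cconv S phi x + cconv S psi x.
Proof.
rewrite /cconv -[RHS]linearP; congr (S _); exact/val_inj/funext.
Qed.

Lemma cconvB S x phi psi : cconv S (phi - psi) x = cconv S phi x - cconv S psi x.
Proof. by rewrite addrC -scaleN1r cconvP mulN1r addrC. Qed.

Lemma cconvZ S x (a : R[i]) phi : cconv S (a *: phi) x = a * cconv S phi x.
Proof.
have c0 : cconv S 0 x = 0 by rewrite -(subrr (0 : smoothfun R d)) cconvB subrr.
by rewrite -[a *: phi]addr0 cconvP c0 addr0.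
Qed.

Lemma cconv_translate S x v phi : cconv S phi (x + v) = cconv S (translate v phi) x.
Proof.
congr (S _); apply/val_inj/funext => y /=.
by rewrite /affine scale1r addrA (addrC v).
Qed.

Lemma cconv_bound S : exists Q l c, [/\ compact Q, 0 <= c &
  forall phi x M, 0 <= M ->
    (forall w y, (size w <= l)%N -> Q y -> normc (partials w phi (x - y)) <= M) ->
    normc (cconv S phi x) <= c * M].
Proof.
case: S => S [Q [l [c [cQ Sc]]]]; exists Q, l, `|c|; split=> // phi x M M0 HM.
apply: le_trans (Sc _) _; apply: (@le_trans _ _ (`|c| * seminorm Q l (smooth_refl x phi))).
  apply: ler_wpM2r; last exact: ler_norm.
  exact: (seminorm_ge0 l cQ (fun _ _ => I) (smoothfunP _)).
apply: ler_wpM2l => //; apply: seminorm_le => // a y al Qy.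
rewrite /mderive partials_refl normcZ_real normrX normrN1 expr1n mul1r.
by apply: HM; rewrite ?size_mword.
Qed.

Lemma compact_reflect x K : compact K -> compact [set x - y | y in K].
Proof.
move=> cK; have -> : [set x - y | y in K] = [set x + (-1) *: y | y in K].
  by under [RHS]eq_imagel do rewrite scaleN1r.
apply: continuous_compact cK.
by apply: continuous_subspaceT; exact: continuous_affine.
Qed.

(** [S] is controlled by finitely many derivatives on one compact set, hence is
    continuous for uniform convergence of all derivatives on compact sets. *)
Lemma cconv_small S x (T : Type) (F : set_system T) {FF : Filter F}
    (phi : T -> smoothfun R d) :
  (forall w K, compact K -> forall eps, 0 < eps ->
    \forall t \near F, forall z, K z -> normc (partials w (phi t) z) <= eps) ->
  forall eps, 0 < eps -> \forall t \near F, normc (cconv S (phi t) x) <= eps.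
Proof.
move=> Hphi eps eps0; have [Q [l [c [cQ c0 Sc]]]] := cconv_bound S.
have c1 : 0 < c + 1 by rewrite ltr_wpDl.
have M0 : 0 < eps / (c + 1) by rewrite divr_gt0.
have small w := Hphi w _ (@compact_reflect x _ cQ) _ M0.
apply: filterS (near_words l small) => t Ht.
apply: le_trans (Sc _ _ _ (ltW M0) _) _.
  by move=> w y wl Qy; apply: Ht => //; exists y.
by rewrite mulrCA ger_pMr// ler_pdivrMr// mul1r lerDl.
Qed.

Lemma ccontinuous_cconv S phi x : ccontinuous_at (cconv S phi) x.
Proof.
apply: ccontinuous_normc => eps eps0.
have H := @cconv_small S x E (nbhs (0 : E)) (nbhs_filter _) (fun v => translate v phi - phi).
apply: filterS (H _ _ eps0) => [v|w K cK e e0].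
  by rewrite cconvB cconv_translate.
have cp y : ccontinuous_at (partials w phi) y := (smoothfunP phi w I).1.
apply: filterS (uniform_continuity cK cp e0) => v Hv z Kz.
rewrite partialsBT; [|exact: smoothfunP|exact: smoothfunP].
by rewrite !fctE partials_translate; exact: Hv.
Qed.

(** The derivatives of a difference quotient of [phi] are the difference quotients
    of its derivatives, because partial derivatives commute; hence [cconv_small]
    applies to the difference between the quotient and the derivative. *)
Lemma derivable_cconv S phi x i :
  cderivable (cconv S phi) x (delta_mx 0 i) /\
  partial i (cconv S phi) x = cconv S (derivative [:: i] phi) x.
Proof.
apply: cderivable_normc => eps eps0.
pose q (h : R) : smoothfun R d :=
  (h^-1)%:C *: (translate (h *: delta_mx 0 i) phi - phi) - derivative [:: i] phi.
have H := @cconv_small S x R (0^') (dnbhs_filter _) q.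
apply: filterS (H _ _ eps0) => [h|w K cK e e0].
  by rewrite /q cconvB cconvZ cconvB -cconv_translate [x + _]addrC.
have sw := smooth_partials w (smoothfunP phi).
apply: filterS (difference_quotient_cvg i sw cK e0) => h Hh z Kz.
have sB := smoothB (smoothfunP (translate (h *: delta_mx 0 i) phi)) (smoothfunP phi).
rewrite partialsBT; [|exact: smoothfunP|exact: smoothfunP].
rewrite partialsZT// partialsBT; [|exact: smoothfunP|exact: smoothfunP].
rewrite !fctE partials_translate -[partials w _ z in X in _ - X]/(partials w (partial i phi) z).
by rewrite partials_partial; [exact: Hh|exact: smoothfunP].
Qed.

Lemma partials_cconv S phi w :
  partials w (cconv S phi) = cconv S (derivative w phi).
Proof.
elim: w => [|i w /= ->].
  by apply/funext => x; congr (S _); exact/val_inj.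
apply/funext => x; rewrite (derivable_cconv S _ x i).2.
by congr (S _); exact/val_inj.
Qed.

Lemma smooth_cconv S phi : smooth_on setT (cconv S phi).
Proof.
move=> w x _; rewrite partials_cconv; split; first exact: ccontinuous_cconv.
by move=> i; exact: (derivable_cconv S _ x i).1.
Qed.

(** For [x] in [K], the value at [x] of the convolution only involves [phi] on
    [x - Q], where [Q] carries [S]; these sets lie in the compact set [K - Q]. *)
Lemma seminorm_cconv S K l : compact K -> exists K' n c, [/\ compact K', 0 <= c &
  forall phi M, 0 <= M ->
    (forall w z, (size w <= n)%N -> K' z -> normc (partials w phi z) <= M) ->
    seminorm K l (cconv S phi) <= c * M].
Proof.
move=> cK; have [Q [m [c [cQ c0 Sc]]]] := cconv_bound S.
exists [set xy.1 - xy.2 | xy in K `*` Q], (m + l)%N, c; split=> //.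
  apply: continuous_compact (compact_setX cK cQ).
  apply: continuous_subspaceT => xy; apply: continuousB; [exact: cvg_fst|exact: cvg_snd].
move=> phi M M0 HM; apply: seminorm_le; first exact: mulr_ge0.
move=> a x al Kx; rewrite /mderive partials_cconv; apply: Sc => // w y wm Qy.
rewrite -partials_cat; apply: HM; last by exists (x, y).
by rewrite size_cat size_mword leq_add.
Qed.

End Convolution.

(** * Derivatives of mollifiers and cutoffs *)

Section Mollifiers.
Context {R : realType} {d : nat}.
Local Notation E := 'rV[R]_d.
Implicit Types (f g : E -> R[i]) (x y z v : E) (i j : 'I_d) (w u : seq 'I_d)
  (rho : schwartz R d) (chi : testfun R d) (e : R).

Lemma partials_mollifier (rho : smoothfun R d) e w z :
  partials w (mollifier rho e) z =
  (e ^- d * e ^- size w)%:C * partials w rho (e^-1 *: z).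
Proof.
have -> : (mollifier rho e : E -> R[i]) = (e ^- d)%:C *: affine 0 e^-1 rho.
  by apply/funext => x; rewrite /= /mollifier_fun !fctE /affine add0r.
have sr := smoothfunP rho.
rewrite partialsZT; last exact: smooth_affine.
rewrite partials_affine// !fctE /affine add0r exprVn rmorphM /=.
by rewrite -[_ *: _]/(_ * (_ * _)) mulrA.
Qed.

Lemma schwartz_bounded rho w : exists M, forall x, normc (partials w rho x) <= M.
Proof.
rewrite partials_mderive; last exact: smoothfunP.
case: rho => rho rd /=; have [M HM] := rd [ffun i => count_mem i w] [ffun=> 0%N].
exists M => x; have := HM x; rewrite /monomial big1 ?mul1r// => i _.
by rewrite ffunE.
Qed.

(** The sup norm of [x] is the absolute value of one of its coordinates, so the
    pure powers of the coordinates are all the monomials that matter. *)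
Lemma schwartz_decay rho N w : exists M, forall (r : R) x, 0 < r -> r <= `|x| ->
  r ^+ N * normc (partials w rho x) <= M.
Proof.
rewrite partials_mderive; last exact: smoothfunP.
case: rho => rho rd /=; set a := [ffun i => _].
have /choice[M HM] (i : 'I_d) := rd a [ffun j => if j == i then N else 0%N].
exists (\sum_i `|M i|) => r x r0 rx.
have [[k i] /= xi] : exists ij, `|x| = `|x ij.1 ij.2|.
  by apply: mx_norm_neq0; rewrite gt_eqF// (lt_le_trans r0).
rewrite ord1 in xi.
have mi : monomial [ffun j => if j == i then N else 0%N] x = x 0 i ^+ N.
  rewrite /monomial (bigD1 i)//= ffunE eqxx big1 ?mulr1// => j /negbTE ji.
  by rewrite ffunE ji.
apply: (@le_trans _ _ (normc ((x 0 i ^+ N)%:C * mderive a rho x))).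
  rewrite normcZ_real ler_wpM2r ?normc_ge0// normrX -xi.
  by rewrite lerXn2r// nnegrE ?normr_ge0// ltW.
rewrite -mi (le_trans (HM i x))// (le_trans (ler_norm _))//.
by rewrite (bigD1 i)//= lerDl sumr_ge0.
Qed.

Lemma testfun_bounded chi w : exists M, forall x, normc (partials w chi x) <= M.
Proof.
have cK := @testfun_compact _ _ chi.
have [M M0 HM] := smooth_bounded w cK (fun _ _ => I) (testfunP chi).
exists M => x; have [/HM//|nx] := pselect (supp chi x).
have oA : open (~` supp chi) by apply: closed_openC; exact: closed_closure.
have e0 : {in ~` supp chi, chi =1 cst 0} by move=> y /set_mem /supp0.
rewrite (partials_eq w oA e0) ?inE//.
suff -> : partials w (cst 0 : E -> R[i]) = cst 0 by rewrite normc0.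
by elim: w {HM} => [//|i w /= ->]; exact: partial_cst.
Qed.

Lemma partials_cst w (c : R[i]) x : normc (partials w (cst c : E -> R[i]) x) <= normc c.
Proof.
case/lastP: w => [//|w i]; rewrite partials_rcons partial_cst.
suff -> : partials w (0 : E -> R[i]) = 0 by rewrite normc0 normc_ge0.
by elim: w => [//|j w /= ->]; exact: partial_cst.
Qed.

(** The Leibniz formula for a derivative of order [k] has [2 ^ k] terms. *)
Lemma partialsM_le f g z w (A B : R) : smooth_on setT f -> smooth_on setT g ->
  (forall u, (size u <= size w)%N -> normc (partials u f z) <= A) ->
  (forall u, (size u <= size w)%N -> normc (partials u g z) <= B) ->
  normc (partials w (f * g) z) <= 2 ^+ size w * (A * B).
Proof.
elim/last_ind: w f g => [|w i IH] f g sf sg fA gB.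
  rewrite mul1r /= !fctE normcM ler_pM ?normc_ge0//; [exact: (fA [::])|exact: (gB [::])].
have e : partial i (f * g) = partial i f * g + f * partial i g.
  apply/funext => x; apply: partialM.
    exact: (smooth_cderivable i sf (I : setT x)).
  exact: (smooth_cderivable i sg (I : setT x)).
have sfg := smoothM openT (smooth_partial i sf) sg.
have sfg' := smoothM openT sf (smooth_partial i sg).
rewrite partials_rcons e (partialsD w openT sfg sfg') ?inE//.
rewrite size_rcons exprS -mulrA mulr_natl mulr2n.
rewrite size_rcons in fA gB.
apply: le_trans (normcD_le _ _) _; apply: lerD.
  apply: IH => // [|u uw|u uw]; first exact: smooth_partial.
    by rewrite -partials_rcons; apply: fA; rewrite size_rcons.
  by apply: gB; exact: leqW.
apply: IH => // [|u uw|u uw]; first exact: smooth_partial.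
  by apply: fA; exact: leqW.
by rewrite -partials_rcons; apply: gB; rewrite size_rcons.
Qed.

(** The mollifiers are cut off along Euclidean balls, while the estimates use the
    sup norm; the constant is not sharp but positive in every dimension. *)
Lemma enorm_le x : enorm x <= d.+1%:R * `|x|.
Proof.
rewrite -[leRHS]ger0_norm ?mulr_ge0// -sqrtr_sqr ler_wsqrtr//.
apply: (@le_trans _ _ (\sum_(i < d) `|x| ^+ 2)).
  apply: ler_sum => i _; rewrite -real_normK ?num_real// lerXn2r ?nnegrE//.
  have -> : `|x| = \big[Num.max/0]_ij `|x ij.1 ij.2| by exact: mx_normrE.
  exact: (le_bigmax _ (fun ij => `|x ij.1 ij.2|) (0, i)).
rewrite sumr_const card_ord -[leLHS]mulr_natl exprMn ler_wpM2r ?sqr_ge0//.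
rewrite -natrX ler_nat (leq_trans (leqnSn d))// -{1}(muln1 d.+1) leq_mul//.
Qed.

(** The logarithm loses to every power of [e]: half a power is enough here. *)
Lemma ln_le_sqrtV e : 0 < e < 1 -> 1 + `|ln e| <= 2 * (Num.sqrt e)^-1.
Proof.
move=> /andP[e0 e1]; set s := Num.sqrt e.
have s0 : 0 < s by rewrite sqrtr_gt0.
have -> : e = s ^+ 2 by rewrite sqr_sqrtr// ltW.
have s1 : s < 1 by rewrite -sqrtr1 ltr_sqrt.
rewrite lnXn// normrMn ltr0_norm ?ln_lt0 ?s0// -lnV ?posrE//.
have v1 : 1 < s^-1 by rewrite invf_gt1.
have vs : ln s^-1 <= s^-1 - 1.
  by have := @le_ln1Dx R (s^-1 - 1); rewrite subrKC; apply; lra.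
by rewrite -mulr_natl; lra.
Qed.

Lemma theta_smooth_subproof (rho : smoothfun R d) chi e :
  theta_fun rho chi e \in smooth_pred.
Proof.
have -> : theta_fun rho chi e = (mollifier rho e : E -> R[i]) * affine 0 `|ln e| chi.
  by apply/funext => x; rewrite !fctE /affine add0r.
apply/asboolP; apply: (smoothM openT (smoothfunP _)).
exact/smooth_affine/testfunP.
Qed.

(** The formula of [theta] is smooth for every [e], which frees the estimates from
    the proof that [theta] takes as an argument. *)
Definition theta_smooth (rho : smoothfun R d) chi e : smoothfun R d :=
  SmoothFun (theta_smooth_subproof rho chi e).

End Mollifiers.

(** * The tail of a mollifier *)

Section Tail.
Context {R : realType} {d : nat}.
Local Notation E := 'rV[R]_d.
Implicit Types (f g : E -> R[i]) (x y z v : E) (i j : 'I_d) (w u : seq 'I_d)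
  (rho : schwartz R d) (chi : testfun R d) (e : R).

Lemma mollifier_cost e n w : 0 < e <= 1 -> (size w <= n)%N ->
  `|e ^- d * e ^- size w| <= e ^- (d + n).
Proof.
move=> /andP[e0 e1] wn; have e0' := ltW e0.
rewrite -invfM -exprD ger0_norm ?invr_ge0 ?exprn_ge0//.
rewrite lef_pV2 ?posrE ?exprn_gt0//.
by apply: ler_wiXn2l; rewrite ?leq_add2l.
Qed.

Lemma mollifier_moderate rho n : exists2 C, 0 <= C & forall e w z,
  0 < e <= 1 -> (size w <= n)%N ->
  normc (partials w (mollifier rho e) z) <= C * e ^- (d + n).
Proof.
have [|C C0 HC] := @words_bound R d (fun w C => forall x, normc (partials w rho x) <= C) n _
  (schwartz_bounded rho).
  by move=> w M N MN HM x; exact: le_trans MN.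
exists C => // e w z e01 wn.
rewrite partials_mollifier normcZ_real mulrC ler_pM ?normc_ge0 ?HC//.
exact: mollifier_cost.
Qed.

Definition cutoff chi e : E -> R[i] := cst 1 - affine 0 `|ln e| chi.

Lemma mollifier_tailE rho chi e :
  (mollifier rho e - theta_smooth rho chi e : E -> R[i]) =
  (mollifier rho e : E -> R[i]) * cutoff chi e.
Proof.
by apply/funext => x; rewrite /cutoff !fctE /affine add0r mulrBr mulr1.
Qed.

Lemma smooth_cutoff chi e : smooth_on setT (cutoff chi e).
Proof.
by apply: smoothB; [exact: smooth_cst|exact/smooth_affine/testfunP].
Qed.

Lemma cutoff_bound chi n : exists2 M, 0 <= M & forall e w z, (size w <= n)%N ->
  normc (partials w (cutoff chi e) z) <= (1 + `|ln e|) ^+ n * M.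
Proof.
have [|M M0 HM] := @words_bound R d (fun w C => forall x, normc (partials w chi x) <= C) n _
  (testfun_bounded chi).
  by move=> w M N MN HM x; exact: le_trans MN.
exists (1 + M) => [|e w z wn]; first by rewrite addr_ge0.
have L1 : 1 <= 1 + `|ln e| by rewrite lerDl.
have Ln : 1 <= (1 + `|ln e|) ^+ n by exact: exprn_ege1.
rewrite partialsBT; [|exact: smooth_cst|exact/smooth_affine/testfunP].
rewrite fctE (le_trans (normcB_le _ _))// mulrDr mulr1 lerD//.
  by rewrite (le_trans (partials_cst _ _ _))// normc1.
rewrite partials_affine; last exact: testfunP.
rewrite fctE -[_ *: _]/(_ * _) normcZ_real ler_pM ?normc_ge0//; last exact: HM.
rewrite normrX normr_id (@le_trans _ _ ((1 + `|ln e|) ^+ size w))//.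
  by rewrite lerXn2r ?nnegrE ?addr_ge0// lerDr.
by rewrite ler_weXn2l.
Qed.

Lemma cutoff_near0 chi e z : (forall x, enorm x <= 1 -> chi x = 1) -> 0 < e < 1 ->
  `|z| < (d.+1%:R * `|ln e|)^-1 -> cutoff chi e z = 0.
Proof.
move=> chi1 /andP[e0 e1] zr; rewrite /cutoff !fctE /affine add0r chi1 ?subrr//.
have L0 : 0 < `|ln e| by rewrite normr_gt0 lt_eqF// ln_lt0// e0.
apply: le_trans (enorm_le _) _; rewrite normrZ normr_id mulrA.
by rewrite -ler_pdivlMl ?mulr_gt0// mulr1 ltW.
Qed.

(** Near the origin the cutoff kills the difference of the two mollifiers. At a
    distance at least [c / `|ln e|] from it, the rapid decay of [rho] yields
    [e ^+ N * `|ln e| ^+ N] for any [N], while scaling and differentiation cost at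
    most [e ^- (d + n)] for the mollifier and a power [n] of [1 + `|ln e|] for the
    cutoff. *)
Lemma mollifier_tail rho chi (chi1 : forall x, enorm x <= 1 -> chi x = 1) n p :
  exists2 C, 0 <= C & forall e w z, 0 < e < 1 -> (size w <= n)%N ->
  normc (partials w (mollifier rho e - theta_smooth rho chi e) z) <= C * e ^+ p.
Proof.
(* Bounding 1 + `|ln e| by 2 / s with s = sqrt e leaves the power
   e^N * s^-(N + n) * e^-(d + n), which is e^p for this N. *)
pose N := (2 * d + 3 * n + 2 * p)%N.
have [|D D0 HD] := @words_bound R d (fun w C => forall (r : R) x, 0 < r -> r <= `|x| ->
    r ^+ N * normc (partials w rho x) <= C) n _ (schwartz_decay rho N).
  by move=> w M M' MM HM r x r0 rx; apply: le_trans MM; exact: HM.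
have [B B0 HB] := cutoff_bound chi n.
exists (2 ^+ n * (D * d.+1%:R ^+ N * 2 ^+ (N + n) * B)).
  by rewrite !mulr_ge0 ?exprn_ge0.
move=> e w z e01 wn; have /andP[e0 e1] := e01.
have L0 : 0 < `|ln e| by rewrite normr_gt0 lt_eqF// ln_lt0// e0.
have C0 : 0 < d.+1%:R * `|ln e| by rewrite mulr_gt0.
rewrite mollifier_tailE.
have sm := smoothfunP (mollifier rho e); have sc := smooth_cutoff chi e.
set r := (d.+1%:R * `|ln e|)^-1; have r0 : 0 < r by rewrite invr_gt0.
have [zr|zr] := ltP `|z| r.
  have e0' : {in (ball (0 : E) r : set E), (mollifier rho e : E -> R[i]) * cutoff chi e =1 cst 0}.
    move=> y; rewrite inE -ball_normE /= sub0r normrN => yr.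
    by rewrite !fctE (cutoff_near0 chi1)// mulr0.
  rewrite (partials_eq w _ e0'); [|exact: ball_open|].
    by rewrite (le_trans (partials_cst _ _ _))// normc0 !mulr_ge0 ?exprn_ge0 ?(ltW e0).
  by rewrite inE -ball_normE /= sub0r normrN.
have decay u : (size u <= size w)%N -> normc (partials u (mollifier rho e) z) <=
    e ^- (d + n) * (D * (e * (d.+1%:R * `|ln e|)) ^+ N).
  move=> uw; have un := leq_trans uw wn.
  rewrite partials_mollifier normcZ_real ler_pM ?normc_ge0//.
    by apply: mollifier_cost; rewrite // e0 ltW.
  have re0 : 0 < e^-1 * r by rewrite mulr_gt0// invr_gt0.
  have := HD u un (e^-1 * r) (e^-1 *: z) re0.
  rewrite normrZ gtr0_norm ?invr_gt0// ler_pM2l ?invr_gt0// => /(_ zr).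
  by rewrite -ler_pdivlMl ?exprn_gt0// mulrC -exprVn invfM !invrK.
apply: le_trans (partialsM_le sm sc decay _) _.
  by move=> u uw; apply: HB; exact: leq_trans wn.
rewrite -[leRHS]mulrA ler_pM ?exprn_ge0//.
- by rewrite !mulr_ge0 ?invr_ge0 ?exprn_ge0 ?mulr_ge0 ?(ltW e0) ?addr_ge0.
- by rewrite ler_weXn2l// ler1n.
have s0 : 0 < Num.sqrt e by rewrite sqrtr_gt0.
set s := Num.sqrt e in s0.
have es : e = s ^+ 2 by rewrite sqr_sqrtr// ltW.
have Ls := ln_le_sqrtV e01; rewrite -/s in Ls.
have LN : `|ln e| ^+ N <= (2 * s^-1) ^+ N.
  by rewrite lerXn2r ?nnegrE ?mulr_ge0 ?invr_ge0 ?(ltW s0)// (le_trans _ Ls)// lerDr.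
have Ln : (1 + `|ln e|) ^+ n <= (2 * s^-1) ^+ n.
  by rewrite lerXn2r ?nnegrE ?addr_ge0 ?mulr_ge0 ?invr_ge0 ?(ltW s0).
apply: (@le_trans _ _ ((e ^- (d + n) * (D * (e * d.+1%:R) ^+ N)) * (2 * s^-1) ^+ (N + n) * B)).
  have -> : e * (d.+1%:R * `|ln e|) = e * d.+1%:R * `|ln e| by rewrite mulrA.
  rewrite (exprD _ N n) (exprMn N (e * d.+1%:R)) [leLHS]mulrA ler_wpM2r//.
  rewrite [leRHS]mulrA ler_pM ?exprn_ge0 ?addr_ge0//.
    by rewrite !mulr_ge0 ?invr_ge0 ?exprn_ge0 ?mulr_ge0 ?(ltW e0).
  rewrite -[leRHS]mulrA ler_wpM2l ?invr_ge0 ?exprn_ge0 ?(ltW e0)//.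
  by rewrite -[leRHS]mulrA ler_wpM2l// ler_wpM2l// exprn_ge0 ?mulr_ge0 ?(ltW e0).
rewrite le_eqVlt; apply/orP; left; apply/eqP.
have e2N : e ^+ N = e ^+ (d + n) * s ^+ (N + n) * e ^+ p.
  by rewrite es -!exprM -!exprD; congr (_ ^+ _); rewrite /N; lia.
have s0' : s ^+ (N + n) != 0 by rewrite expf_neq0 ?lt0r_neq0.
have e0' : e ^+ (d + n) != 0 by rewrite expf_neq0 ?lt0r_neq0.
rewrite exprMn e2N exprMn exprVn.
by field; rewrite s0' e0'.
Qed.

End Tail.

(** * Nets of convolutions *)

Section Nets.
Context {R : realType} {d : nat}.
Local Notation E := 'rV[R]_d.
Implicit Types (f g : E -> R[i]) (x y z v : E) (w u : seq 'I_d)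
  (chi psi : testfun R d) (e : R) (S : cdistribution R d) (T : Defs.distribution R d)
  (K : set E) (Omega : opens R d).

(** The spare factor [e] turns an upper bound into a little-o. *)
Lemma littleo_bound (F h : R -> R) (C : R) :
  (\forall e \near 0^'+, `|F e| <= C * e * `|h e|) -> F =o_ (0^'+) h.
Proof.
move=> Fh; apply/eqoP => eps eps0.
have C1 : 0 < `|C| + 1 by rewrite ltr_wpDl.
have small : \forall e \near (0 : R)^'+, e < eps / (`|C| + 1).
  by apply: nbhs_right_lt; rewrite divr_gt0.
apply: filterS3 Fh small (nbhs_right_gt 0) => e Fe es e0.
apply: le_trans Fe _; apply: ler_wpM2r => //.
rewrite (@le_trans _ _ ((`|C| + 1) * e))// ?ler_wpM2r ?(ltW e0)//.
  by rewrite (le_trans (ler_norm _))// lerDl.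
by rewrite mulrC -ler_pdivlMr// ltW.
Qed.

Lemma near_eq_littleo (F G h : R -> R) : (\forall e \near 0^'+, F e = G e) ->
  F =o_ (0^'+) h -> G =o_ (0^'+) h.
Proof.
move=> FG /eqoP Fh; apply/eqoP => eps eps0.
by apply: filterS2 FG (Fh _ eps0) => e <-.
Qed.

Lemma near01_open : \forall e \near (0 : R)^'+, 0 < e < 1.
Proof.
apply: filterS2 (nbhs_right_gt 0) (nbhs_right_lt (ltr01 : (0 : R) < 1)) => e e0 e1.
by rewrite e0.
Qed.

Lemma eq_seminorm (A : set E) K l f g : open A -> K `<=` A -> {in A, f =1 g} ->
  seminorm K l f = seminorm K l g.
Proof.
move=> oA KA fg; rewrite /seminorm; congr sup; apply/seteqP; split => t [a al [x Kx <-]].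
  exists a => //; exists x => //.
  by rewrite /mderive (partials_eq (mword a) oA fg)//; exact/mem_set/KA.
exists a => //; exists x => //.
by rewrite /mderive (partials_eq (mword a) oA fg)//; exact/mem_set/KA.
Qed.

Lemma seminorm_cconv_moderate S (phi : R -> smoothfun R d) (q : nat -> nat) :
  (forall n, exists2 C, 0 <= C & forall e w z, 0 < e < 1 -> (size w <= n)%N ->
     normc (partials w (phi e) z) <= C * e ^- q n) ->
  forall K l, compact K -> exists r : nat,
    (fun e => seminorm K l (cconv S (phi e))) =o_ (0^'+) (fun e => e ^- r).
Proof.
move=> Hphi K l cK; have [K' [n [c [cK' c0 HS]]]] := seminorm_cconv S l cK.
have [C C0 HC] := Hphi n; exists (q n).+1; apply: (@littleo_bound _ _ (c * C)).
apply: filterS near01_open => e e01; have /andP[e0 e1] := e01.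
rewrite !ger0_norm ?invr_ge0 ?exprn_ge0 ?(ltW e0)//; last first.
  exact: (seminorm_ge0 l cK (fun _ _ => I) (smooth_cconv S _)).
rewrite exprS invfM mulrA mulfK ?lt0r_neq0// -mulrA; apply: HS => [|w z wn _].
  by rewrite mulr_ge0// invr_ge0 exprn_ge0// ltW.
exact: HC.
Qed.

Lemma negligible_cconv S (phi : R -> smoothfun R d) Omega :
  (forall n p, exists2 C, 0 <= C & forall e w z, 0 < e < 1 -> (size w <= n)%N ->
     normc (partials w (phi e) z) <= C * e ^+ p) ->
  negligible_net Omega (fun e => cconv S (phi e)).
Proof.
move=> Hphi l K cK _ p; have [K' [n [c [cK' c0 HS]]]] := seminorm_cconv S l cK.
have [C C0 HC] := Hphi n p.+1; apply: (@littleo_bound _ _ (c * C)).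
apply: filterS near01_open => e e01; have /andP[e0 e1] := e01.
rewrite !ger0_norm ?exprn_ge0 ?(ltW e0)//; last first.
  exact: (seminorm_ge0 l cK (fun _ _ => I) (smooth_cconv S _)).
rewrite -!mulrA -exprS; apply: HS => [|w z wn _]; last exact: HC.
by rewrite mulr_ge0// exprn_ge0// ltW.
Qed.

Lemma compact_closed_ball x (r : R) : compact [set y | `|x - y| <= r].
Proof.
apply: bounded_closed_compact; last exact: closed_closed_ball_.
exists (`|x| + r); split; first exact: num_real.
move=> M rM y /= xy; apply: le_trans (ltW rM).
by rewrite -lerBlDl (le_trans _ xy)// distrC lerB_dist.
Qed.

Lemma compact_norm_bounded K : compact K -> exists2 M, 0 < M & forall x, K x -> `|x| < M.
Proof.
move=> /compact_bounded[M [_ HM]]; exists (`|M| + 2); first by rewrite ltr_wpDl.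
move=> x Kx; apply: (@le_lt_trans _ _ (`|M| + 1)); last by rewrite ltrD2l ltr1n.
by apply: (HM (`|M| + 1)) => //; rewrite (le_lt_trans (ler_norm M))// ltrDl.
Qed.

Lemma testfun_vanishes psi : exists2 M, 0 < M & forall x, M <= `|x| -> psi x = 0.
Proof.
have [M M0 HM] := compact_norm_bounded (@testfun_compact _ _ psi).
exists M => // x Mx; apply: supp0 => /HM; by rewrite ltNge Mx.
Qed.

(** Dilating [chi] gives cutoff functions for arbitrarily large balls. *)
Lemma cutoff_exists chi (chi1 : forall x, enorm x <= 1 -> chi x = 1) (M : R) : 0 < M ->
  exists psi, forall x, `|x| <= M -> psi x = 1.
Proof.
move=> M0; have c0 : 0 < (d.+1%:R * M)^-1 by rewrite invr_gt0 mulr_gt0.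
have test : affine 0 (d.+1%:R * M)^-1 chi \in test_pred.
  apply/asboolP; split; first exact/smooth_affine/testfunP.
  apply: compact_supp_affine; first exact: lt0r_neq0.
  exact: testfun_compact.
exists (TestFun test) => x xM /=; rewrite /affine add0r chi1//.
apply: le_trans (enorm_le _) _; rewrite normrZ gtr0_norm// mulrCA.
by rewrite ler_pdivrMl ?mulr_gt0// mulr1 ler_wpM2l.
Qed.

Lemma conv_cconv T psi (phi : testfun R d) (phi' : smoothfun R d) x :
  phi =1 phi' -> (forall y, phi (x - y) = 0 \/ psi y = 1) ->
  Defs.conv T phi x = cconv (mulD psi T) phi' x.
Proof.
move=> pp' H; congr (T _); apply/val_inj/funext => y /=.
rewrite !fctE -pp'; have [->|->] := H y; first by rewrite mulr0.
by rewrite mul1r.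
Qed.

(** Smoothness is local, and on a ball the convolution with a test function only
    sees a bounded part of [T], which a cutoff function makes compactly
    supported. *)
Lemma smooth_conv chi (chi1 : forall x, enorm x <= 1 -> chi x = 1) T (phi : testfun R d) :
  smooth_on setT (Defs.conv T phi).
Proof.
move=> w x _; have [M M0 HM] := testfun_vanishes phi.
have [|psi psi1] := @cutoff_exists chi chi1 (`|x| + 1 + M); first by rewrite addr_gt0.
have smooth_phi : (phi : E -> R[i]) \in smooth_pred by exact/asboolP/testfunP.
have e : {in (ball (0 : E) (`|x| + 1) : set E),
    cconv (mulD psi T) (SmoothFun smooth_phi) =1 Defs.conv T phi}.
  move=> z; rewrite inE -ball_normE /= sub0r normrN => zr.
  apply/esym/conv_cconv => // y; have [yM|/psi1] := ltP (`|x| + 1 + M) `|y|; last by right.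
  left; apply: HM; rewrite ltW// distrC.
  apply: lt_le_trans (lerB_dist _ _); rewrite ltrBrDl.
  by rewrite (lt_trans _ yM)// ltrD2r.
have sB : smooth_on (ball (0 : E) (`|x| + 1)) (Defs.conv T phi).
  by apply: (smooth_eq (ball_open _ _) e) => w' y _; exact: smooth_cconv.
by apply: sB; rewrite -ball_normE /= sub0r normrN ltrDl.
Qed.

End Nets.

Section Theta.
Context {R : realType} {d : nat}.
Local Notation E := 'rV[R]_d.
Implicit Types (f g : E -> R[i]) (x y z v : E) (w u : seq 'I_d) (rho : schwartz R d)
  (chi psi : testfun R d) (e : R) (S : cdistribution R d) (T : Defs.distribution R d)
  (K : set E) (Omega : opens R d).

Definition iotaS_net (rho : smoothfun R d) chi T : R -> E -> R[i] := fun e =>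
  if @idP (0 < e < 1) is ReflectT e01 then Defs.conv T (theta rho chi e01) else 0.

(** The test function in the net depends on the proof found by the case analysis,
    so the two cases are best separated once, for an arbitrary property. *)
Lemma iotaS_net_ind (rho : smoothfun R d) chi T e (P : (E -> R[i]) -> Prop) :
  (forall e01 : 0 < e < 1, P (Defs.conv T (theta rho chi e01))) ->
  (~ (0 < e < 1) -> P 0) -> P (iotaS_net rho chi T e).
Proof.
have elim (Q : Prop) b (r : reflect Q b) (g : Q -> E -> R[i]) :
    (forall q, P (g q)) -> (~ Q -> P 0) -> P (if r is ReflectT q then g q else 0).
  by case: r => [q Pg _|nq _]; exact.
exact: elim.
Qed.

(** The supports of the functions [theta_fun rho chi e] shrink to the origin. Once
    they are smaller than the distance from [closure Omega] to the complement of
    [U], the convolution at a point of [Omega] only sees [T] where [psi] is 1. *)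
Lemma iotaS_net_local (rho : smoothfun R d) chi T psi Omega (U : set E) :
  compact (closure Omega) -> open U -> closure Omega `<=` U ->
  (forall x, U x -> psi x = 1) ->
  \forall e \near 0^'+, {in (Omega : set E),
    iotaS_net rho chi T e =1 cconv (mulD psi T) (theta_smooth rho chi e)}.
Proof.
move=> cO oU OU psi1; have [M M0 HM] := testfun_vanishes chi.
have : \forall v \near (0 : E), forall x, closure Omega x -> U (x + v).
  have := cO => /compact_near_coveringP cO'.
  refine (cO' E (nbhs (0 : E)) (fun v x => U (x + v)) _ _) => x /OU Ux.
  have /nbhs_ballP[r /= r0 rU] := open_nbhs_nbhs (conj oU Ux).
  have r20 : 0 < r / 2 by rewrite divr_gt0.
  exists (ball x (r / 2), ball (0 : E) (r / 2)); first by split; exact: nbhsx_ballx.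
  move=> [z v] [/=]; rewrite -ball_normE /= sub0r normrN => xz vr.
  apply: rU; rewrite -ball_normE /= opprD addrA.
  by rewrite (le_lt_trans (ler_normB _ _))// [ltRHS]splitr ltrD.
move=> /nbhs_ballP[r /= r0 rU].
(* For such e, chi (`|ln e| *: z) vanishes as soon as r <= `|z|. *)
have lnr : \forall e \near (0 : R)^'+, e < expR (- (M / r)).
  by apply: nbhs_right_lt; exact: expR_gt0.
apply: filterS2 near01_open lnr => e e01 er x /set_mem Ox.
have /andP[e0 e1] := e01.
apply: (iotaS_net_ind (P := fun f => f x = _)) => // e01'; apply: conv_cconv => // y.
have [yr|yr] := ltP `|x - y| r; [right|left].
  apply: psi1; rewrite -[y](subKr x); apply: rU; last exact: subset_closure.
  by rewrite -ball_normE /= sub0r opprK.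
rewrite /= /theta_fun HM ?mulr0// normrZ normr_id ltr0_norm ?ln_lt0//.
have lne : M / r <= - ln e.
  by rewrite lerNr -[leRHS]expRK ler_ln ?posrE ?expR_gt0// ltW.
rewrite -[leLHS](divfK (lt0r_neq0 r0)) ler_pM ?divr_ge0 ?(ltW r0) ?(ltW M0)//.
Qed.

Section Moderate.
Context (rho : schwartz R d) (chi : testfun R d)
  (chi1 : forall x, enorm x <= 1 -> chi x = 1).

Lemma theta_moderate n : exists2 C, 0 <= C & forall e w z,
  0 < e < 1 -> (size w <= n)%N ->
  normc (partials w (theta_smooth rho chi e) z) <= C * e ^- (d + n).
Proof.
have [C C0 HC] := mollifier_moderate rho n.
have [C' C'0 HC'] := mollifier_tail rho chi1 n 0.
exists (C + C') => [|e w z e01 wn]; first exact: addr_ge0.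
have /andP[e0 e1] := e01.
have -> : (theta_smooth rho chi e : E -> R[i]) = mollifier rho e -
    (mollifier rho e - theta_smooth rho chi e : smoothfun R d).
  by apply/funext => x /=; rewrite !fctE subKr.
rewrite partialsBT; [|exact: smoothfunP|exact: smoothfunP].
rewrite fctE (le_trans (normcB_le _ _))// mulrDl lerD//.
  by apply: HC; rewrite // e0 ltW.
apply: le_trans (HC' e w z e01 wn) _; rewrite expr0 ler_wpM2l//.
by rewrite invf_ge1 ?exprn_gt0// exprn_ile1// ltW.
Qed.

Lemma moderate_mollifier S Omega : moderate Omega (fun e => cconv S (mollifier rho e)).
Proof.
split=> [e _ w x _|l K cK _]; first exact: smooth_cconv.
apply: (@seminorm_cconv_moderate _ _ _ _ (addn d)) => // n.
have [C C0 HC] := mollifier_moderate rho n.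
by exists C => // e w z /andP[e0 e1]; apply: HC; rewrite e0 ltW.
Qed.

Lemma negligible_tail S Omega : negligible_net Omega
  (fun e => cconv S (mollifier rho e - theta_smooth rho chi e)).
Proof. by apply: negligible_cconv => n p; exact: mollifier_tail. Qed.

(** On a ball around the given compact set, [T] may be replaced by a cutoff of it
    for small [e], and the cutoff is independent of [e]. *)
Lemma moderate_iotaS T : moderate (fullspace R d) (iotaS_net rho chi T).
Proof.
split=> [e _|l K cK _].
  apply: iotaS_net_ind => [e01|_]; first exact: (smooth_conv chi1).
  exact: (@smooth_cst R d setT 0).
have [M M0 KM] := compact_norm_bounded cK.
have M1 : 0 < M + 1 by rewrite addr_gt0.
have [psi psi1] := cutoff_exists chi1 M1.
pose Omega := Opens (ball_open (0 : E) M).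
have bM x : (Omega : set E) x <-> `|x| < M by rewrite /= -ball_normE /= sub0r normrN.
have cB := @compact_closed_ball R d 0 M.
have clB : closure Omega `<=` [set y | `|0 - y| <= M].
  have -> : [set y | `|0 - y| <= M] = closure [set y : E | `|0 - y| <= M].
    by apply/closure_id/closed_closed_ball_.
  by apply: closureS => x /bM xM /=; rewrite sub0r normrN ltW.
have cO : compact (closure Omega).
  by apply: subclosed_compact cB clB; exact: closed_closure.
have cU : closure Omega `<=` ball (0 : E) (M + 1).
  by move=> x /clB; rewrite -ball_normE /= => /le_lt_trans; apply; rewrite ltrDl.
have psiU x : ball (0 : E) (M + 1) x -> psi x = 1.
  by rewrite -ball_normE /= sub0r normrN => xM; apply/psi1/ltW.
have [r Hr] := seminorm_cconv_moderate (mulD psi T) theta_moderate l cK.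
exists r; apply: near_eq_littleo Hr.
apply: filterS (iotaS_net_local rho chi T cO (ball_open _ _) cU psiU) => e eq_e.
apply/esym/(eq_seminorm l (opensP Omega) _ eq_e) => x /KM xM.
exact/bM.
Qed.

End Moderate.
End Theta.

(** * Classes of nets, and the comparison of the two embeddings *)

Section Classes.
Context {R : realType} {d : nat}.
Local Notation E := 'rV[R]_d.
Implicit Types (F G : R -> E -> R[i]) (Omega : opens R d).

Lemma net_classE Omega F (mF : F \in moderate_pred Omega) :
  net_class Omega F = (\pi_(colombeau Omega) (ModerateNet mF))%qT.
Proof.
congr (\pi_(colombeau Omega) _)%qT; apply/val_inj => /=.
by rewrite insubdK.
Qed.

Lemma eq_net_class Omega F G : moderate Omega F -> moderate Omega G ->
  negligible_net Omega (F - G) -> net_class Omega F = net_class Omega G.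
Proof.
move=> mF mG FG.
rewrite (net_classE (asboolT mF)) (net_classE (asboolT mG)).
by apply/eqP; rewrite -Quotient.idealrBE; exact/asboolP.
Qed.

Lemma restrict_net_class Omega F : moderate (fullspace R d) F ->
  moderate Omega F /\
  Defs.restrict (@sub_fullspace R d Omega) (net_class (fullspace R d) F) = net_class Omega F.
Proof.
move=> mF; have mF' := restrict_net_subproof (@sub_fullspace R d Omega)
  (ModerateNet (asboolT mF : F \in moderate_pred (fullspace R d))).
split; first exact/asboolP.
rewrite (net_classE (asboolT mF)) restrict_pi (net_classE mF').
by congr (\pi_(colombeau Omega) _)%qT; exact/val_inj.
Qed.

(** Negligibility is a local property: the compact sets on which it is tested are
    covered by finitely many compact balls, each inside a member of the cover. *)
Lemma negligible_local (L : Type) (Omega : L -> opens R d) F : open_cover Omega ->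
  (forall e, 0 < e <= 1 -> smooth_on setT (F e)) ->
  (forall l, negligible_net (Omega l) F) -> negligible_net (fullspace R d) F.
Proof.
move=> cover sF negF k K cK _ p; apply/eqoP => eps eps0.
have : \forall e \near (0 : R)^'+, forall x, K x -> forall a, (mdegree a <= k)%N ->
    normc (mderive a (F e) x) <= eps * `|e ^+ p|.
  have := cK => /compact_near_coveringP cK'.
  refine (cK' R (0^'+) (fun e x => forall a, (mdegree a <= k)%N ->
    normc (mderive a (F e) x) <= eps * `|e ^+ p|) _ _) => x Kx.
  have [l _ Ox] : (\bigcup_l (Omega l : set E)) x by rewrite cover.
  have /nbhs_ballP[r /= r0 rO] := open_nbhs_nbhs (conj (opensP (Omega l)) Ox).
  have r20 : 0 < r / 2 by rewrite divr_gt0.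
  have cB := @compact_closed_ball R d x (r / 2).
  have BO : [set y | `|x - y| <= r / 2] `<=` Omega l.
    move=> y /= xy; apply: rO; rewrite -ball_normE /= (le_lt_trans xy)//.
    by rewrite [ltRHS]splitr ltrDl.
  have /eqoP/(_ _ eps0) small := negF l k _ cB BO p.
  exists (ball x (r / 2), [set e | 0 < e <= 1 /\
      `|seminorm [set y | `|x - y| <= r / 2] k (F e)| <= eps * `|e ^+ p|]).
    by split; [exact: nbhsx_ballx|apply: filterS2 near01 small => e].
  move=> [y e] [/= xy [e01 Fe]] a ak.
  apply: le_trans (le_trans (ler_norm _) Fe).
  apply: (seminorm_ub cB (fun _ _ => I) (sF _ e01) ak).
  by move: xy; rewrite -ball_normE /= => /ltW.
apply: filterS2 near01 => e e01 He.
have bound : seminorm K k (F e) <= eps * `|e ^+ p|.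
  by apply: seminorm_le => [|a x ak Kx]; [rewrite mulr_ge0// ltW|exact: He].
by rewrite ger0_norm//; exact: (seminorm_ge0 k cK (fun _ _ => I) (sF _ e01)).
Qed.

(** One half of the sheaf property: it makes the map described by [iotaA]
    unique. *)
Lemma colombeau_separated (L : Type) (Omega : L -> opens R d) :
  open_cover Omega -> forall u v : colombeau (fullspace R d),
  (forall l, Defs.restrict (@sub_fullspace R d (Omega l)) u =
             Defs.restrict (@sub_fullspace R d (Omega l)) v) -> u = v.
Proof.
move=> cover u v uv; rewrite -[u]reprK -[v]reprK.
apply/eqP; rewrite -Quotient.idealrBE; apply/asboolP/(negligible_local cover).
  move=> e e01; apply: (smooth_netB (Omega := fullspace R d)).
    exact: (moderate_netP (repr u)).1 e e01.
  exact: (moderate_netP (repr v)).1 e e01.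
move=> l; move: (uv l) => /eqP; rewrite /Defs.restrict -Quotient.idealrBE.
by move=> /asboolP.
Qed.

End Classes.

Theorem proposition9 (R : realType) (d : nat) (d_gt0 : (0 < d)%N)
  (rho : schwartz R d)
  (rho_even : forall x : 'rV[R]_d, rho (- x) = rho x)
  (rho_integral : cintegral rho = 1)
  (rho_moments : forall m : {ffun 'I_d -> nat}, m != [ffun=> 0%N] ->
    cintegral (fun x : 'rV[R]_d => (monomial m x)%:C * rho x) = 0)
  (chi : testfun R d)
  (chi01 : forall x : 'rV[R]_d, 0 <= chi x <= 1)
  (chi1 : forall x : 'rV[R]_d, enorm x <= 1 -> chi x = 1)
  (chi0 : forall x : 'rV[R]_d, 2 <= enorm x -> chi x = 0)
  (L : Type) (Omega : L -> opens R d)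
  (Omega_cover : open_cover Omega)
  (Omega_locally_finite : locally_finite Omega)
  (Omega_compact : forall l, compact (closure (Omega l)))
  (psi : L -> testfun R d)
  (psi01 : forall l (x : 'rV[R]_d), 0 <= psi l x <= 1)
  (psi1 : forall l, exists U : set 'rV[R]_d,
    [/\ open U, closure (Omega l) `<=` U & forall x, U x -> psi l x = 1]) :
  iotaA rho Omega psi = iotaS rho chi.
Proof.
have iotaS_coherent l T : Defs.restrict (@sub_fullspace R d (Omega l)) (iotaS rho chi T) =
    iota_loc rho (Omega l) (psi l) T.
  have [mS eS] := restrict_net_class (Omega l) (moderate_iotaS rho chi1 T).
  have [mA eA] := restrict_net_class (Omega l)
    (moderate_mollifier rho (mulD (psi l) T) (fullspace R d)).
  rewrite [LHS]eS [RHS]eA; apply/esym/(eq_net_class mA mS) => k K cK KO p.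
  have [U [oU OU psiU]] := psi1 l.
  apply: near_eq_littleo (negligible_tail rho chi1 (mulD (psi l) T) k cK KO p).
  apply: filterS (iotaS_net_local rho chi T (Omega_compact l) oU OU psiU) => e eq_e.
  apply: (eq_seminorm k (opensP (Omega l)) KO) => x xO.
  by rewrite cconvB !fctE eq_e.
have iotaA_coherent : forall l T, Defs.restrict (@sub_fullspace R d (Omega l))
    (iotaA rho Omega psi T) = iota_loc rho (Omega l) (psi l) T.
  apply: (@xgetPex _ (fun=> 0) [set iota | forall l T,
    Defs.restrict (@sub_fullspace R d (Omega l)) (iota T) = iota_loc rho (Omega l) (psi l) T]).
  by exists (iotaS rho chi).
apply/funext => T; apply: (colombeau_separated Omega_cover) => l.
by rewrite iotaA_coherent iotaS_coherent.
Qed.
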